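(* For every terminating presentation $\Sigma$ of a category $\mathbf{C}$, the homotopical completion-reduction $\mathcal{R}(\Sigma)$ of $\Sigma$ is a coherent presentation of $\mathbf{C}$. Here $\Sigma$ is a terminating $2$-polygraph equipped with a total termination order, and $\mathcal{R}(\Sigma)=\pi_\Gamma(\mathcal{S}(\Sigma))$ is obtained from the homotopical completion $\mathcal{S}(\Sigma)$ of $\Sigma$ by homotopical reduction with respect to some collapsible part $\Gamma$ of $\mathcal{S}(\Sigma)$.
   Context: **Polygraphs and coherent presentations.** All $n$-categories are strict and globular; $f\star_i g$ is composition along $i$-cells in diagrammatic order. A $2$-polygraph consists of a set $\Sigma_0$ of $0$-cells, a set $\Sigma_1$ of generating $1$-cells with source and target in $\Sigma_0$ (generating the free category $\Sigma_1^*$), and a set $\Sigma_2$ of generating $2$-cells, each with source and target a pair of parallel $1$-cells of $\Sigma_1^*$. $\Sigma_2^*$ is the free $2$-category and $\Sigma_2^\top$ the free $(2,1)$-category it generates (inverses written $f^-$). The category presented is the quotient of $\Sigma_1^*$ by the congruence generated by $\Sigma_2$; a presentation of $\mathbf{C}$ is a $2$-polygraph whose presented category is isomorphic to $\mathbf{C}$. A $(3,1)$-polygraph is a $2$-polygraph together with a set $\Sigma_3$ of generating $3$-cells, each with source and target a pair of parallel $2$-cells of $\Sigma_2^\top$; it generates a free $(3,1)$-category $\Sigma^\top$ ($2$- and $3$-cells invertible); the category it presents is the one presented by its underlying $2$-polygraph. It is a coherent presentation of $\mathbf{C}$ if the category it presents is isomorphic to $\mathbf{C}$ and any two parallel $2$-cells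 of $\Sigma_2^\top$ become equal in the quotient $\Sigma_2^\top/\Sigma_3$. **Rewriting.** A rewriting step is a $2$-cell $w\alpha w'$ of $\Sigma_2^*$ with $\alpha\in\Sigma_2$ and $w,w'$ $1$-cells of $\Sigma_1^*$. A normal form is a $1$-cell that is the source of no rewriting step. $\Sigma$ terminates if there is no infinite sequence of composable rewriting steps. A termination order is a well-founded order on $1$-cells, compatible with composition, with $s(f)>t(f)$ for every rewriting step $f$. A branching is an unordered pair $(f,g)$ of $2$-cells of $\Sigma_2^*$ with a common source; it is confluent if there are $2$-cells $f',g'$ of $\Sigma_2^*$ with common target such that $f\star_1f'$ and $g\star_1g'$ are defined. It is local if $f,g$ are rewriting steps. A local branching is aspherical if $f=g$, Peiffer if it has the form $(fv,ug)$ with $u=s(f)$, $v=s(g)$, and overlap otherwise. Local branchings are ordered by inclusion of their sources, and a minimal overlap branching is called critical. **Homotopical completion.** Given a terminating $\Sigma$ with a total termination order $\le$, define an increasing sequence of $(3,1)$-polygraphs $(\Sigma,\emptyset)=\Sigma^0\subseteq\Sigma^1\subseteq\cdots$, where $\Sigma^{n+1}$ is obtained from $\Sigma^n$ by completing its critical branchings, as follows. For a critical branching $(f:u\Rightarrow v,\ g:u\Rightarrow w)$, consider $2$-cells $f':v\Rightarrow\hat v$ and $g':w\Rightarrow\hat w$ of the free $2$-category, with $\hat v$ and $\hat w$ normal forms. If the branching is confluent, these are taken with $\hat v=\hat w$, and one adds a $3$-cell $\gamma:f\star_1f'\Rrightarrow g\star_1g'$. Otherwise, one adds a $2$-cell $\alpha$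 between $\hat v$ and $\hat w$, directed from $\hat v$ to $\hat w$ if $\hat v>\hat w$ and in the reverse direction otherwise, together with a $3$-cell $\gamma$ filling the resulting diagram ($\gamma:f\star_1f'\star_1\alpha\Rrightarrow g\star_1g'$ if $\alpha:\hat v\Rightarrow\hat w$, or $\gamma:f\star_1f'\Rrightarrow g\star_1g'\star_1\alpha$ if $\alpha:\hat w\Rightarrow\hat v$). The homotopical completion $\mathcal{S}(\Sigma)$ is the union of the $\Sigma^n$. **Collapsible cells.** In a $(3,1)$-polygraph $\Xi$, a generating $2$-cell (resp. generating $3$-cell, resp. a $3$-sphere, i.e. a pair (source, target) of parallel $3$-cells of $\Xi^\top$) $\gamma$ is collapsible if its target $t(\gamma)$ is a generating $1$-cell (resp. $2$-cell, $3$-cell) of $\Xi$ and its source is a $1$-cell (resp. $2$-cell, $3$-cell) of the free $(3,1)$-category over $\Xi\setminus\{t(\gamma)\}$; the target is then called redundant. Collapsibility up to a Nielsen transformation means that $\gamma$ may first be modified by compositions of the following replacements: a $2$-cell or a $3$-cell by a formal inverse; a $3$-cell $\gamma:f\Rrightarrow g$ by a $3$-cell $h\star_1f\star_1k\Rrightarrow h\star_1g\star_1k$ with $h,k$ $2$-cells of $\Xi^\top$; a $3$-sphere by one obtained from it by composition with $2$-cells and $3$-cells of $\Xi^\top$. Source and target of $\gamma$ below then refer to the modified $\gamma$. **Collapsible part and homotopical reduction.** A collapsible part of $\Xi$ is a triple $\Gamma=(\Gamma_2,\Gamma_3,\Gamma_4)$ made of a family $\Gamma_2$ of generating $2$-cells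 of $\Xi$, a family $\Gamma_3$ of generating $3$-cells of $\Xi$ and a family $\Gamma_4$ of $3$-spheres of $\Xi^\top$ such that: every $\gamma$ of every $\Gamma_k$ is collapsible (potentially up to a Nielsen transformation); no $\gamma$ of any $\Gamma_k$ is redundant for some element of $\Gamma_{k+1}$; and there exist well-founded order relations on the $1$-cells, $2$-cells and $3$-cells of $\Xi$ such that, for every $\gamma$ in every $\Gamma_k$, the target of $\gamma$ is strictly greater than every generating $(k-1)$-cell that occurs in the source of $\gamma$. In that case, a map $\pi_\Gamma$ is defined by well-founded induction through the recursive assignment $\pi_\Gamma(x)=\pi_\Gamma(s(\gamma))$ if $x=t(\gamma)$ for $\gamma$ in $\Gamma$, $\pi_\Gamma(x)=1_{\pi_\Gamma(s(\gamma))}$ if $x=\gamma$ is in $\Gamma$, and $\pi_\Gamma(x)=x$ otherwise. The homotopical reduction of $\Xi$ with respect to $\Gamma$ is $\pi_\Gamma:\Xi^\top\to\Xi^\top/\Gamma$; its target is freely generated by the $(3,1)$-polygraph $\Xi/\Gamma$ (also denoted $\pi_\Gamma(\Xi)$) obtained from $\Xi$ by removing the cells of $\Gamma$ and the corresponding redundant cells, and by replacing the source and target maps of $\Xi$ by their compositions with $\pi_\Gamma$.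
   Formalization: In a collapsible part, each redundant 1-cell or 2-cell is required to be the target of exactly one element of Γ; otherwise (e.g. y⇒x and z⇒x both in Γ) the map π_Γ is not well defined and the reduction need not present C. *)

(* Defs.v *)
From Stdlib Require Import List FinFun ClassicalEpsilon ProofIrrelevance.
From Stdlib Require Import FunctionalExtensionality PropExtensionality.
Import ListNotations.

Set Implicit Arguments.
Unset Strict Implicit.
Unset Printing Implicit Defensive.

Record category : Type := Category {
  obj : Type;
  hom : obj -> obj -> Type;
  idm : forall x, hom x x;
  cmp : forall x y z, hom x y -> hom y z -> hom x z;   (* diagrammatic order *)
  cmp_assoc : forall x y z t (f : hom x y) (g : hom y z) (h : hom z t),
    cmp (cmp f g) h = cmp f (cmp g h);
  cmp_idl : forall x y (f : hom x y), cmp (idm x) f = f;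
  cmp_idr : forall x y (f : hom x y), cmp f (idm y) = f }.

Record functor (C D : category) : Type := Functor {
  fobj : obj C -> obj D;
  fhom : forall x y, hom x y -> hom (fobj x) (fobj y);
  fhom_id : forall x, fhom (idm x) = idm (fobj x);
  fhom_cmp : forall x y z (f : hom x y) (g : hom y z),
    fhom (cmp f g) = cmp (fhom f) (fhom g) }.

Definition isomorphic (C D : category) : Prop :=
  exists F : functor C D,
    Bijective (fobj F) /\ forall x y, Bijective (@fhom _ _ F x y).

(** A polygraph is given by raw data together with a separate predicate
    ([is_polygraph2], [is_polygraph3]) requiring sources and targets to be
    parallel cells of the free category of the dimension below.  A 1-cell of
    the free category is a [word] satisfying [cell1]; the starting 0-cell is
    recorded so that identities on distinct 0-cells are distinct words. *)

Record graph : Type := Graph {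
  C0 : Type;
  C1 : Type;
  s0 : C1 -> C0;
  t0 : C1 -> C0 }.

Record word (G : graph) : Type := Word {
  start : C0 G;
  letters : list (C1 G) }.

Section Words.
Variable G : graph.
Implicit Types u v : word G.

Fixpoint end_from (x : C0 G) (l : list (C1 G)) : C0 G :=
  match l with [] => x | a :: l' => end_from (t0 a) l' end.

Fixpoint path_from (x : C0 G) (l : list (C1 G)) : Prop :=
  match l with [] => True | a :: l' => s0 a = x /\ path_from (t0 a) l' end.

Definition stop u : C0 G := end_from (start u) (letters u).
Definition cell1 u : Prop := path_from (start u) (letters u).
Definition id1 (x : C0 G) : word G := Word x [].
Definition letter (a : C1 G) : word G := Word (s0 a) [a].
Definition wcat u v : word G := Word (start u) (letters u ++ letters v).
Definition parallel1 u v : Prop := start u = start v /\ stop u = stop v.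

End Words.

Record polygraph2 : Type := Polygraph2 {
  base1 :> graph;
  C2 : Type;
  s1 : C2 -> word base1;
  t1 : C2 -> word base1 }.

Definition is_polygraph2 (P : polygraph2) : Prop :=
  forall a : C2 P, cell1 (s1 a) /\ cell1 (t1 a) /\ parallel1 (s1 a) (t1 a).

(** 2-cells of the free (2,1)-category are raw terms, subject to the typing judgement [cell2 u v f]
    (read [f : u => v]) and to the judgemental equality [eq2 E u v f g].  With
    [E] empty ([free2]), equality is the one of the free (2,1)-category; in
    general it is the one of its quotient by the congruence generated by
    [E]. *)

Inductive tm2 (P : polygraph2) : Type :=
| Gen2 (a : C2 P)
| Id2 (u : word P)
| Comp0 (f g : tm2 P)
| Comp1 (f g : tm2 P)
| Inv2 (f : tm2 P).

Arguments Id2 {P} u.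

Inductive cell2 (P : polygraph2) : word P -> word P -> tm2 P -> Prop :=
| cell2_gen a : cell2 (s1 a) (t1 a) (Gen2 a)
| cell2_id u : cell1 u -> cell2 u u (Id2 u)
| cell2_comp0 u v u' v' f g :
    cell2 u v f -> cell2 u' v' g -> stop u = start u' ->
    cell2 (wcat u u') (wcat v v') (Comp0 f g)
| cell2_comp1 u v w f g :
    cell2 u v f -> cell2 v w g -> cell2 u w (Comp1 f g)
| cell2_inv u v f : cell2 u v f -> cell2 v u (Inv2 f).

Inductive eq2 (P : polygraph2) (E : tm2 P -> tm2 P -> Prop) :
  word P -> word P -> tm2 P -> tm2 P -> Prop :=
| eq2_base u v f g :
    E f g -> cell2 u v f -> cell2 u v g -> eq2 E u v f g
| eq2_refl u v f : cell2 u v f -> eq2 E u v f f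
| eq2_sym u v f g : eq2 E u v f g -> eq2 E u v g f
| eq2_trans u v f g h : eq2 E u v f g -> eq2 E u v g h -> eq2 E u v f h
| eq2_comp0 u v u' v' f f' g g' :
    eq2 E u v f f' -> eq2 E u' v' g g' -> stop u = start u' ->
    eq2 E (wcat u u') (wcat v v') (Comp0 f g) (Comp0 f' g')
| eq2_comp1 u v w f f' g g' :
    eq2 E u v f f' -> eq2 E v w g g' -> eq2 E u w (Comp1 f g) (Comp1 f' g')
| eq2_inv u v f f' : eq2 E u v f f' -> eq2 E v u (Inv2 f) (Inv2 f')
| eq2_assoc1 u v w x f g h :
    cell2 u v f -> cell2 v w g -> cell2 w x h ->
    eq2 E u x (Comp1 (Comp1 f g) h) (Comp1 f (Comp1 g h))
| eq2_idl1 u v f : cell2 u v f -> eq2 E u v (Comp1 (Id2 u) f) f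
| eq2_idr1 u v f : cell2 u v f -> eq2 E u v (Comp1 f (Id2 v)) f
| eq2_invr u v f : cell2 u v f -> eq2 E u u (Comp1 f (Inv2 f)) (Id2 u)
| eq2_invl u v f : cell2 u v f -> eq2 E v v (Comp1 (Inv2 f) f) (Id2 v)
| eq2_assoc0 u v u' v' u'' v'' f g h :
    cell2 u v f -> cell2 u' v' g -> cell2 u'' v'' h ->
    stop u = start u' -> stop u' = start u'' ->
    eq2 E (wcat u (wcat u' u'')) (wcat v (wcat v' v''))
      (Comp0 (Comp0 f g) h) (Comp0 f (Comp0 g h))
| eq2_idl0 u v f :
    cell2 u v f -> eq2 E u v (Comp0 (Id2 (id1 (start u))) f) f
| eq2_idr0 u v f :
    cell2 u v f -> eq2 E u v (Comp0 f (Id2 (id1 (stop u)))) f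
| eq2_id0 u v : cell1 u -> cell1 v -> stop u = start v ->
    eq2 E (wcat u v) (wcat u v) (Comp0 (Id2 u) (Id2 v)) (Id2 (wcat u v))
| eq2_exchange u v w u' v' w' f g f' g' :
    cell2 u v f -> cell2 v w g -> cell2 u' v' f' -> cell2 v' w' g' ->
    stop u = start u' ->
    eq2 E (wcat u u') (wcat w w')
      (Comp0 (Comp1 f g) (Comp1 f' g')) (Comp1 (Comp0 f f') (Comp0 g g')).

Definition free2 (P : polygraph2) (f g : tm2 P) : Prop := False.

Fixpoint occ2 (P : polygraph2) (a : C2 P) (f : tm2 P) : Prop :=
  match f with
  | Gen2 b => b = a
  | Id2 _ => False
  | Comp0 g h | Comp1 g h => occ2 a g \/ occ2 a h
  | Inv2 g => occ2 a g
  end.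

Fixpoint positive (P : polygraph2) (f : tm2 P) : Prop :=
  match f with
  | Gen2 _ | Id2 _ => True
  | Comp0 g h | Comp1 g h => positive g /\ positive h
  | Inv2 _ => False
  end.

Inductive congr (P : polygraph2) : word P -> word P -> Prop :=
| congr_gen a : congr (s1 a) (t1 a)
| congr_refl u : cell1 u -> congr u u
| congr_sym u v : congr u v -> congr v u
| congr_trans u v w : congr u v -> congr v w -> congr u w
| congr_cat u u' v v' : congr u u' -> congr v v' -> stop u = start v ->
    congr (wcat u v) (wcat u' v').

Section PresentedCategory.
Variable P : polygraph2.

Lemma end_from_app (G : graph) (x : C0 G) l m :
  end_from x (l ++ m) = end_from (end_from x l) m.
Proof. revert x; induction l as [|a l IH]; simpl; auto. Qed.

Lemma path_from_app (G : graph) (x : C0 G) l m :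
  path_from x (l ++ m) <-> path_from x l /\ path_from (end_from x l) m.
Proof.
revert x; induction l as [|a l IH]; simpl; intros x; [tauto|].
rewrite IH; tauto.
Qed.

Lemma stop_wcat (G : graph) (u v : word G) :
  stop u = start v -> stop (wcat u v) = stop v.
Proof.
intros E; unfold stop in *; simpl; rewrite end_from_app, E; reflexivity.
Qed.

Lemma cell1_wcat (G : graph) (u v : word G) :
  cell1 u -> cell1 v -> stop u = start v -> cell1 (wcat u v).
Proof.
unfold cell1, stop; simpl; intros Hu Hv E; apply path_from_app; rewrite E; auto.
Qed.

Lemma wcat_assoc (G : graph) (u v w : word G) :
  wcat (wcat u v) w = wcat u (wcat v w).
Proof. unfold wcat; simpl; rewrite app_assoc; reflexivity. Qed.

Lemma wcat_id1 (G : graph) (u : word G) x : wcat u (id1 x) = u.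
Proof. destruct u; unfold wcat; simpl; rewrite app_nil_r; reflexivity. Qed.

Lemma id1_wcat (G : graph) (u : word G) : wcat (id1 (start u)) u = u.
Proof. destruct u; reflexivity. Qed.

Definition is_class (x y : C0 P) (K : word P -> Prop) : Prop :=
  exists u, cell1 u /\ start u = x /\ stop u = y /\ K = congr u.

Definition class (x y : C0 P) : Type := {K : word P -> Prop | is_class x y K}.

Lemma class_eq x y (K L : class x y) : proj1_sig K = proj1_sig L -> K = L.
Proof.
destruct K as [K HK], L as [L HL]; simpl; intros E; subst L.
rewrite (proof_irrelevance _ HK HL); reflexivity.
Qed.

Lemma congr_eq (u v : word P) : congr u v -> congr u = congr v.
Proof.
intros H; apply functional_extensionality; intros w.
apply propositional_extensionality; split; intros H'.
- eapply congr_trans; [apply congr_sym|]; eassumption.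
- eapply congr_trans; eassumption.
Qed.

Definition class_prod (K L : word P -> Prop) (w : word P) : Prop :=
  exists u v, K u /\ L v /\ stop u = start v /\ congr (wcat u v) w.

Lemma class_prodE (u v : word P) :
  cell1 u -> cell1 v -> stop u = start v ->
  class_prod (congr u) (congr v) = congr (wcat u v).
Proof.
intros Hu Hv E; apply functional_extensionality; intros w.
apply propositional_extensionality; split.
- intros (u' & v' & H & H' & _ & Hw).
  eapply congr_trans; [|exact Hw]; apply congr_cat; auto.
- intros Hw; exists u, v; auto using congr_refl.
Qed.

Lemma class_prod_class x y z K L :
  is_class x y K -> is_class y z L -> is_class x z (class_prod K L).
Proof.
intros (u & Hu & <- & Eu & ->) (v & Hv & Ev & <- & ->).
assert (E : stop u = start v) by congruence.
exists (wcat u v); rewrite class_prodE; auto.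
repeat split; auto using cell1_wcat, stop_wcat.
Qed.

Definition class_cmp x y z (K : class x y) (L : class y z) : class x z :=
  exist _ _ (class_prod_class (proj2_sig K) (proj2_sig L)).

Lemma class_id_class (x : C0 P) : is_class x x (congr (id1 x)).
Proof. exists (id1 x); repeat split. Qed.

Definition class_id (x : C0 P) : class x x := exist _ _ (class_id_class x).

Lemma class_cmp_assoc x y z t (K : class x y) (L : class y z) (M : class z t) :
  class_cmp (class_cmp K L) M = class_cmp K (class_cmp L M).
Proof.
apply class_eq; destruct K as [K (u & Hu & E1 & E2 & ->)].
destruct L as [L (v & Hv & E3 & E4 & ->)], M as [M (w & Hw & E5 & E6 & ->)].
simpl; assert (Ev : stop u = start v) by congruence.
assert (Ew : stop v = start w) by congruence.
rewrite !class_prodE; auto using cell1_wcat.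
- rewrite wcat_assoc; reflexivity.
- rewrite stop_wcat; auto.
Qed.

Lemma class_cmp_idl x y (K : class x y) : class_cmp (class_id x) K = K.
Proof.
apply class_eq; destruct K as [K (u & Hu & E1 & E2 & ->)]; simpl; subst x.
rewrite class_prodE; simpl; auto.
- rewrite id1_wcat; reflexivity.
- exact I.
Qed.

Lemma class_cmp_idr x y (K : class x y) : class_cmp K (class_id y) = K.
Proof.
apply class_eq; destruct K as [K (u & Hu & E1 & E2 & ->)]; simpl; subst y.
rewrite class_prodE; simpl; auto.
- rewrite wcat_id1; reflexivity.
- exact I.
Qed.

Definition presented_category : category :=
  Category class_cmp_assoc class_cmp_idl class_cmp_idr.

End PresentedCategory.

Definition presents (P : polygraph2) (C : category) : Prop :=
  is_polygraph2 P /\ isomorphic (presented_category P) C.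

(** The rewriting notions below are relative to a set [A] of generating 2-cells of [P], i.e. to
    the sub-polygraph of [P] with generating 2-cells [A]. *)

Record step (P : polygraph2) : Type := Step {
  lctx : word P;
  rule : C2 P;
  rctx : word P }.

Section Rewriting.
Variables (P : polygraph2) (A : C2 P -> Prop).
Implicit Types (f g : step P) (u v w : word P).

Definition is_step f : Prop :=
  A (rule f) /\ cell1 (lctx f) /\ cell1 (rctx f) /\
  stop (lctx f) = start (s1 (rule f)) /\ stop (s1 (rule f)) = start (rctx f).

Definition step_src f : word P := wcat (lctx f) (wcat (s1 (rule f)) (rctx f)).
Definition step_tgt f : word P := wcat (lctx f) (wcat (t1 (rule f)) (rctx f)).
Definition step_tm f : tm2 P :=
  Comp0 (Id2 (lctx f)) (Comp0 (Gen2 (rule f)) (Id2 (rctx f))).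
Definition whisker w f w' : step P :=
  Step (wcat w (lctx f)) (rule f) (wcat (rctx f) w').

Definition normal_form u : Prop :=
  cell1 u /\ forall f, is_step f -> step_src f <> u.

Definition terminating : Prop :=
  ~ exists f : nat -> step P,
      (forall n, is_step (f n)) /\ forall n, step_tgt (f n) = step_src (f (S n)).

(* [f : u => v] in the free 2-category on [A] *)
Definition free_cell2 u v (f : tm2 P) : Prop :=
  cell2 u v f /\ positive f /\ forall a, occ2 a f -> A a.

(* Branchings are unordered pairs, hence the symmetric definitions; two
   rewriting steps are the same 2-cell when they apply the same generating
   2-cell in the same context. *)
Definition local_branching f g : Prop :=
  is_step f /\ is_step g /\ step_src f = step_src g.

Definition confluent f g : Prop :=
  exists w (f' g' : tm2 P),
    free_cell2 (step_tgt f) w f' /\ free_cell2 (step_tgt g) w g'.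

Definition peiffer_form f g : Prop :=
  exists f1 g1, is_step f1 /\ is_step g1 /\
    stop (step_src f1) = start (step_src g1) /\
    f = whisker (id1 (start (step_src f1))) f1 (step_src g1) /\
    g = whisker (step_src f1) g1 (id1 (stop (step_src g1))).

Definition overlap f g : Prop :=
  local_branching f g /\ f <> g /\ ~ peiffer_form f g /\ ~ peiffer_form g f.

(* Inclusion of local branchings: one is obtained from the other by
   whiskering. *)
Definition branching_included f g f' g' : Prop :=
  exists w w', cell1 w /\ cell1 w' /\
    stop w = start (step_src f) /\ stop (step_src f) = start w' /\
    f' = whisker w f w' /\ g' = whisker w g w'.

Definition critical f g : Prop :=
  overlap f g /\
  forall f1 g1, overlap f1 g1 -> branching_included f1 g1 f g ->
    f1 = f /\ g1 = g.

End Rewriting.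

Definition all2 (P : polygraph2) (a : C2 P) : Prop := True.

Record total_termination_order (P : polygraph2) (lt : word P -> word P -> Prop)
  : Prop := {
  tto_trans : forall u v w, cell1 u -> cell1 v -> cell1 w ->
    lt u v -> lt v w -> lt u w;
  tto_wf : well_founded (fun u v => cell1 u /\ cell1 v /\ lt u v);
  tto_total : forall u v, cell1 u -> cell1 v -> lt u v \/ u = v \/ lt v u;
  tto_catl : forall w u v, cell1 w -> cell1 u -> cell1 v ->
    stop w = start u -> stop w = start v -> lt u v -> lt (wcat w u) (wcat w v);
  tto_catr : forall u v w, cell1 u -> cell1 v -> cell1 w ->
    stop u = start w -> stop v = start w -> lt u v -> lt (wcat u w) (wcat v w);
  tto_step : forall f, is_step (@all2 P) f -> lt (step_tgt f) (step_src f) }.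

Record polygraph3 : Type := Polygraph3 {
  base2 :> polygraph2;
  C3 : Type;
  s2 : C3 -> tm2 base2;
  t2 : C3 -> tm2 base2 }.

Definition is_polygraph3 (X : polygraph3) : Prop :=
  is_polygraph2 X /\
  forall c : C3 X, exists u v, cell2 u v (s2 c) /\ cell2 u v (t2 c).

Definition rel3 (X : polygraph3) (f g : tm2 X) : Prop :=
  exists c : C3 X, f = s2 c /\ g = t2 c.

Definition coherent_presentation (X : polygraph3) (C : category) : Prop :=
  is_polygraph3 X /\ presents X C /\
  forall u v (f g : tm2 X), cell2 u v f -> cell2 u v g ->
    eq2 (@rel3 X) u v f g.

(** In the free (3,1)-category, [cell3 u v f g F] reads [F : f =3=> g : u => v].  Typing is closed under
    equality of 2-cells in the free (2,1)-category. *)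

Inductive tm3 (X : polygraph3) : Type :=
| Gen3 (c : C3 X)
| Id3 (f : tm2 X)
| Star0 (F G : tm3 X)
| Star1 (F G : tm3 X)
| Star2 (F G : tm3 X)
| Inv3 (F : tm3 X).

Arguments Id3 {X} f.

Inductive cell3 (X : polygraph3) :
  word X -> word X -> tm2 X -> tm2 X -> tm3 X -> Prop :=
| cell3_gen u v c : cell2 u v (s2 c) -> cell2 u v (t2 c) ->
    cell3 u v (s2 c) (t2 c) (Gen3 c)
| cell3_id u v f : cell2 u v f -> cell3 u v f f (Id3 f)
| cell3_star0 u v u' v' f g f' g' F G :
    cell3 u v f g F -> cell3 u' v' f' g' G -> stop u = start u' ->
    cell3 (wcat u u') (wcat v v') (Comp0 f f') (Comp0 g g') (Star0 F G)
| cell3_star1 u v w f g f' g' F G :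
    cell3 u v f g F -> cell3 v w f' g' G ->
    cell3 u w (Comp1 f f') (Comp1 g g') (Star1 F G)
| cell3_star2 u v f g h F G :
    cell3 u v f g F -> cell3 u v g h G -> cell3 u v f h (Star2 F G)
| cell3_inv u v f g F : cell3 u v f g F -> cell3 u v g f (Inv3 F)
| cell3_conv u v f g f' g' F : cell3 u v f g F ->
    eq2 (@free2 X) u v f f' -> eq2 (@free2 X) u v g g' -> cell3 u v f' g' F.

Inductive eq3 (X : polygraph3) :
  word X -> word X -> tm2 X -> tm2 X -> tm3 X -> tm3 X -> Prop :=
| eq3_refl u v f g F : cell3 u v f g F -> eq3 u v f g F F
| eq3_sym u v f g F G : eq3 u v f g F G -> eq3 u v f g G F
| eq3_trans u v f g F G H :
    eq3 u v f g F G -> eq3 u v f g G H -> eq3 u v f g F H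
| eq3_conv u v f g f' g' F G : eq3 u v f g F G ->
    eq2 (@free2 X) u v f f' -> eq2 (@free2 X) u v g g' -> eq3 u v f' g' F G
| eq3_star0 u v u' v' f g f' g' F F' G G' :
    eq3 u v f g F F' -> eq3 u' v' f' g' G G' -> stop u = start u' ->
    eq3 (wcat u u') (wcat v v') (Comp0 f f') (Comp0 g g')
      (Star0 F G) (Star0 F' G')
| eq3_star1 u v w f g f' g' F F' G G' :
    eq3 u v f g F F' -> eq3 v w f' g' G G' ->
    eq3 u w (Comp1 f f') (Comp1 g g') (Star1 F G) (Star1 F' G')
| eq3_star2 u v f g h F F' G G' :
    eq3 u v f g F F' -> eq3 u v g h G G' ->
    eq3 u v f h (Star2 F G) (Star2 F' G')
| eq3_inv u v f g F F' :
    eq3 u v f g F F' -> eq3 u v g f (Inv3 F) (Inv3 F')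
| eq3_id u v f g : eq2 (@free2 X) u v f g -> eq3 u v f g (Id3 f) (Id3 g)
| eq3_assoc2 u v f g h k F G H :
    cell3 u v f g F -> cell3 u v g h G -> cell3 u v h k H ->
    eq3 u v f k (Star2 (Star2 F G) H) (Star2 F (Star2 G H))
| eq3_idl2 u v f g F : cell3 u v f g F -> eq3 u v f g (Star2 (Id3 f) F) F
| eq3_idr2 u v f g F : cell3 u v f g F -> eq3 u v f g (Star2 F (Id3 g)) F
| eq3_invr u v f g F :
    cell3 u v f g F -> eq3 u v f f (Star2 F (Inv3 F)) (Id3 f)
| eq3_invl u v f g F :
    cell3 u v f g F -> eq3 u v g g (Star2 (Inv3 F) F) (Id3 g)
| eq3_assoc1 u v w x f g f' g' f'' g'' F G H :
    cell3 u v f g F -> cell3 v w f' g' G -> cell3 w x f'' g'' H ->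
    eq3 u x (Comp1 f (Comp1 f' f'')) (Comp1 g (Comp1 g' g''))
      (Star1 (Star1 F G) H) (Star1 F (Star1 G H))
| eq3_idl1 u v f g F :
    cell3 u v f g F -> eq3 u v f g (Star1 (Id3 (Id2 u)) F) F
| eq3_idr1 u v f g F :
    cell3 u v f g F -> eq3 u v f g (Star1 F (Id3 (Id2 v))) F
| eq3_assoc0 u v u' v' u'' v'' f g f' g' f'' g'' F G H :
    cell3 u v f g F -> cell3 u' v' f' g' G -> cell3 u'' v'' f'' g'' H ->
    stop u = start u' -> stop u' = start u'' ->
    eq3 (wcat u (wcat u' u'')) (wcat v (wcat v' v''))
      (Comp0 f (Comp0 f' f'')) (Comp0 g (Comp0 g' g''))
      (Star0 (Star0 F G) H) (Star0 F (Star0 G H))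
| eq3_idl0 u v f g F :
    cell3 u v f g F ->
    eq3 u v f g (Star0 (Id3 (Id2 (id1 (start u)))) F) F
| eq3_idr0 u v f g F :
    cell3 u v f g F ->
    eq3 u v f g (Star0 F (Id3 (Id2 (id1 (stop u))))) F
| eq3_id1 u v w f g : cell2 u v f -> cell2 v w g ->
    eq3 u w (Comp1 f g) (Comp1 f g) (Star1 (Id3 f) (Id3 g)) (Id3 (Comp1 f g))
| eq3_id0 u v u' v' f g : cell2 u v f -> cell2 u' v' g -> stop u = start u' ->
    eq3 (wcat u u') (wcat v v') (Comp0 f g) (Comp0 f g)
      (Star0 (Id3 f) (Id3 g)) (Id3 (Comp0 f g))
| eq3_exchange12 u v w f g h f' g' h' F G F' G' :
    cell3 u v f g F -> cell3 u v g h G ->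
    cell3 v w f' g' F' -> cell3 v w g' h' G' ->
    eq3 u w (Comp1 f f') (Comp1 h h')
      (Star1 (Star2 F G) (Star2 F' G')) (Star2 (Star1 F F') (Star1 G G'))
| eq3_exchange02 u v u' v' f g h f' g' h' F G F' G' :
    cell3 u v f g F -> cell3 u v g h G ->
    cell3 u' v' f' g' F' -> cell3 u' v' g' h' G' -> stop u = start u' ->
    eq3 (wcat u u') (wcat v v') (Comp0 f f') (Comp0 h h')
      (Star0 (Star2 F G) (Star2 F' G')) (Star2 (Star0 F F') (Star0 G G'))
| eq3_exchange01 u v w u' v' w' f g h k f' g' h' k' F G F' G' :
    cell3 u v f h F -> cell3 v w g k G ->
    cell3 u' v' f' h' F' -> cell3 v' w' g' k' G' -> stop u = start u' ->
    eq3 (wcat u u') (wcat w w')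
      (Comp1 (Comp0 f f') (Comp0 g g')) (Comp1 (Comp0 h h') (Comp0 k k'))
      (Star0 (Star1 F G) (Star1 F' G')) (Star1 (Star0 F F') (Star0 G G')).

Fixpoint occ3 (X : polygraph3) (c : C3 X) (F : tm3 X) : Prop :=
  match F with
  | Gen3 d => d = c
  | Id3 _ => False
  | Star0 G H | Star1 G H | Star2 G H => occ3 c G \/ occ3 c H
  | Inv3 G => occ3 c G
  end.

Definition sphere3 (X : polygraph3) (F G : tm3 X) : Prop :=
  exists u v f g, cell3 u v f g F /\ cell3 u v f g G.

(** A completion is presented through its union: the cells adjoined to [P] are
    graded by the stage [n] at which they are added, so that the [n]-th
    polygraph of the sequence consists of the cells of [P] and of the adjoined
    cells of stage [< n], and a cell of stage [n] completes a critical branching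
    of the [n]-th polygraph. *)

Definition adjoin2 (P : polygraph2) (N : Type) (s t : N -> word P) : polygraph2 :=
  @Polygraph2 P (C2 P + N)%type
    (fun a => match a with inl b => s1 b | inr c => s c end)
    (fun a => match a with inl b => t1 b | inr c => t c end).

Definition before (P : polygraph2) (N : Type) (s t : N -> word P)
    (stage : N -> nat) (n : nat) (a : C2 (adjoin2 s t)) : Prop :=
  match a with inl _ => True | inr c => stage c < n end.

Record homotopical_completion (P : polygraph2) (lt : word P -> word P -> Prop)
  : Type := HomotopicalCompletion {
  new2 : Type;
  new2_src : new2 -> word P;
  new2_tgt : new2 -> word P;
  stage2 : new2 -> nat;
  completed2 : polygraph2 := adjoin2 new2_src new2_tgt;
  new3 : Type;
  new3_src : new3 -> tm2 completed2;
  new3_tgt : new3 -> tm2 completed2;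
  stage3 : new3 -> nat;
  (* the critical branching completed by a 3-cell, and the 2-cell added with
     it, if any *)
  branch_l : new3 -> step completed2;
  branch_r : new3 -> step completed2;
  added2 : new3 -> option new2;
  stage_set (n : nat) : C2 completed2 -> Prop :=
    before (s := new2_src) (t := new2_tgt) stage2 n;
  three_cell (c : new3) (p q : tm2 completed2) : Prop :=
    exists u v, eq2 (@free2 completed2) u v (new3_src c) p /\
                eq2 (@free2 completed2) u v (new3_tgt c) q;
  completion_branch : forall c : new3,
    critical (stage_set (stage3 c)) (branch_l c) (branch_r c);
  completion_cells : forall c : new3,
    let A := stage_set (stage3 c) in
    let f := branch_l c in
    let g := branch_r c in
    exists (v' w' : word completed2) (f' g' : tm2 completed2),
      free_cell2 A (step_tgt f) v' f' /\ free_cell2 A (step_tgt g) w' g' /\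
      normal_form A v' /\ normal_form A w' /\
      match added2 c with
      | None =>
          confluent A f g /\ v' = w' /\
          three_cell c (Comp1 (step_tm f) f') (Comp1 (step_tm g) g')
      | Some a =>
          ~ confluent A f g /\
          (lt w' v' /\ new2_src a = v' /\ new2_tgt a = w' /\
           three_cell c (Comp1 (Comp1 (step_tm f) f') (Gen2 (P := completed2) (inr a)))
                        (Comp1 (step_tm g) g')
           \/
           ~ lt w' v' /\ new2_src a = w' /\ new2_tgt a = v' /\
           three_cell c (Comp1 (step_tm f) f')
                        (Comp1 (Comp1 (step_tm g) g') (Gen2 (P := completed2) (inr a))))
      end;
  completion_stage2 : forall c a, added2 c = Some a -> stage2 a = stage3 c;
  completion_new2 : forall a, exists! c, added2 c = Some a;
  (* Every critical branching of a stage is completed at the next one; whether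
     a branching that has been completed earlier is completed once more is
     left open. *)
  completion_all : forall n f g, critical (stage_set n) f g ->
    exists c, stage3 c <= n /\
      (branch_l c = f /\ branch_r c = g \/ branch_l c = g /\ branch_r c = f);
  completion_once : forall c d, stage3 c = stage3 d ->
    (branch_l c = branch_l d /\ branch_r c = branch_r d \/
     branch_l c = branch_r d /\ branch_r c = branch_l d) -> c = d }.

Definition completion_polygraph (P : polygraph2) (lt : word P -> word P -> Prop)
    (S : homotopical_completion lt) : polygraph3 :=
  @Polygraph3 (completed2 S) (new3 S) (@new3_src _ _ S) (@new3_tgt _ _ S).

(* [nielsen3 f g f' g']: a 3-cell with boundary [(f, g)] can be replaced by one
   with boundary [(f', g')]. *)
Inductive nielsen3 (X : polygraph3) : tm2 X -> tm2 X -> tm2 X -> tm2 X -> Prop :=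
| nielsen3_eq u v f g f' g' :
    eq2 (@free2 X) u v f f' -> eq2 (@free2 X) u v g g' -> nielsen3 f g f' g'
| nielsen3_inv f g : nielsen3 f g g f
| nielsen3_comp u u' v v' f g h k :
    cell2 u v f -> cell2 u v g -> cell2 u' u h -> cell2 v v' k ->
    nielsen3 f g (Comp1 (Comp1 h f) k) (Comp1 (Comp1 h g) k)
| nielsen3_trans f g f' g' f'' g'' :
    nielsen3 f g f' g' -> nielsen3 f' g' f'' g'' -> nielsen3 f g f'' g''.

(* Composition with a 2-cell is composition with its identity 3-cell. *)
Inductive nielsen4 (X : polygraph3) : tm3 X -> tm3 X -> tm3 X -> tm3 X -> Prop :=
| nielsen4_eq u v f g F G F' G' :
    eq3 u v f g F F' -> eq3 u v f g G G' -> nielsen4 F G F' G'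
| nielsen4_l star D F G :
    star = @Star0 X \/ star = @Star1 X \/ star = @Star2 X ->
    sphere3 (star D F) (star D G) -> nielsen4 F G (star D F) (star D G)
| nielsen4_r star D F G :
    star = @Star0 X \/ star = @Star1 X \/ star = @Star2 X ->
    sphere3 (star F D) (star G D) -> nielsen4 F G (star F D) (star G D)
| nielsen4_trans F G F' G' F'' G'' :
    nielsen4 F G F' G' -> nielsen4 F' G' F'' G'' -> nielsen4 F G F'' G''.

(* [collapse2 c = Some (u, x)] means that [c] is in the collapsible part, with
   source [u] and target [x] after the chosen Nielsen transformation; similarly
   for [collapse3] and, on pairs (source, target), [collapse4].  Sources are
   given by representatives that witness both the avoidance of the target and
   the order condition.  The clauses [collapse*_inj] make "the cell whose target
   is x" meaningful, hence the recursive assignment below well-defined. *)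
Record collapsible_part (X : polygraph3) : Type := CollapsiblePart {
  collapse2 : C2 X -> option (word X * C1 X);
  collapse3 : C3 X -> option (tm2 X * C2 X);
  collapse4 : tm3 X * tm3 X -> option (tm3 X * C3 X);
  collapsible2 : forall c u x, collapse2 c = Some (u, x) ->
    (s1 c = u /\ t1 c = letter x \/ s1 c = letter x /\ t1 c = u) /\
    ~ In x (letters u);
  collapsible3 : forall c f x, collapse3 c = Some (f, x) ->
    nielsen3 (s2 c) (t2 c) f (Gen2 x) /\ ~ occ2 x f;
  collapsible4 : forall F G H x, collapse4 (F, G) = Some (H, x) ->
    sphere3 F G /\ nielsen4 F G H (Gen3 x) /\ ~ occ3 x H;
  collapse2_inj : forall c d u v x,
    collapse2 c = Some (u, x) -> collapse2 d = Some (v, x) -> c = d;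
  collapse3_inj : forall c d f g x,
    collapse3 c = Some (f, x) -> collapse3 d = Some (g, x) -> c = d;
  collapse2_not_redundant : forall c f x,
    collapse3 c = Some (f, x) -> collapse2 x = None;
  collapse3_not_redundant : forall p H x,
    collapse4 p = Some (H, x) -> collapse3 x = None;
  lt1 : C1 X -> C1 X -> Prop;
  lt2 : C2 X -> C2 X -> Prop;
  lt3 : C3 X -> C3 X -> Prop;
  lt1_trans : forall a b c, lt1 a b -> lt1 b c -> lt1 a c;
  lt2_trans : forall a b c, lt2 a b -> lt2 b c -> lt2 a c;
  lt3_trans : forall a b c, lt3 a b -> lt3 b c -> lt3 a c;
  lt1_wf : well_founded lt1;
  lt2_wf : well_founded lt2;
  lt3_wf : well_founded lt3;
  collapse2_lt : forall c u x, collapse2 c = Some (u, x) ->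
    forall y, In y (letters u) -> lt1 y x;
  collapse3_lt : forall c f x, collapse3 c = Some (f, x) ->
    forall y, occ2 y f -> lt2 y x;
  collapse4_lt : forall p H x, collapse4 p = Some (H, x) ->
    forall y, occ3 y H -> lt3 y x }.

Section Reduction.
Variables (X : polygraph3) (K : collapsible_part X).

Definition redundant1 (x : C1 X) : Prop :=
  exists u, exists c, collapse2 K c = Some (u, x).
Definition redundant2 (x : C2 X) : Prop :=
  exists f, exists c, collapse3 K c = Some (f, x).
Definition redundant3 (x : C3 X) : Prop :=
  exists F, exists p, collapse4 K p = Some (F, x).

Definition choose_or {T : Type} (Q : T -> Prop) :
  {t | Q t} + {~ exists t, Q t} :=
  match excluded_middle_informative (exists t, Q t) with
  | left h => inleft (constructive_indefinite_description Q h)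
  | right h => inright h
  end.

Definition reduced_graph : graph :=
  @Graph (C0 X) {x : C1 X | ~ redundant1 x}
    (fun a => s0 (proj1_sig a)) (fun a => t0 (proj1_sig a)).

(* In the recursive calls, the default values are never used; see
   [pi1_redundant] and [pi2_redundant]. *)
Definition pi1_body (x : C1 X)
    (rec : forall y, lt1 K y x -> list (C1 reduced_graph)) :
    list (C1 reduced_graph) :=
  match choose_or (fun u => exists c, collapse2 K c = Some (u, x)) with
  | inleft (exist _ u _) =>
      flat_map (fun y => match excluded_middle_informative (lt1 K y x) with
                         | left h => rec y h
                         | right _ => []
                         end) (letters u)
  | inright h => [exist _ x h]
  end.

Definition pi1 : C1 X -> list (C1 reduced_graph) :=
  Fix (lt1_wf K) (fun _ => list (C1 reduced_graph)) pi1_body.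

Definition pi_word (u : word X) : word reduced_graph :=
  @Word reduced_graph (start u) (flat_map pi1 (letters u)).

Definition kept2 (x : C2 X) : Prop := collapse2 K x = None /\ ~ redundant2 x.

Definition reduced2 : polygraph2 :=
  @Polygraph2 reduced_graph {x : C2 X | kept2 x}
    (fun a => pi_word (s1 (proj1_sig a))) (fun a => pi_word (t1 (proj1_sig a))).

Fixpoint map2 (h : C2 X -> tm2 reduced2) (f : tm2 X) : tm2 reduced2 :=
  match f with
  | Gen2 a => h a
  | Id2 u => Id2 (P := reduced2) (pi_word u)
  | Comp0 f g => Comp0 (map2 h f) (map2 h g)
  | Comp1 f g => Comp1 (map2 h f) (map2 h g)
  | Inv2 f => Inv2 (map2 h f)
  end.

Definition pi2_body (x : C2 X) (rec : forall y, lt2 K y x -> tm2 reduced2) :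
    tm2 reduced2 :=
  match excluded_middle_informative (kept2 x) with
  | left h => Gen2 (P := reduced2) (exist _ x h)
  | right _ =>
      match choose_or (fun f => exists c, collapse3 K c = Some (f, x)) with
      | inleft (exist _ f _) =>
          map2 (fun y => match excluded_middle_informative (lt2 K y x) with
                         | left h => rec y h
                         | right _ => Id2 (P := reduced2) (pi_word (s1 y))
                         end) f
      | inright _ =>
          match collapse2 K x with
          | Some (u, _) => Id2 (P := reduced2) (pi_word u)
          | None => Id2 (P := reduced2) (pi_word (s1 x))
          end
      end
  end.

Definition pi2 : C2 X -> tm2 reduced2 :=
  Fix (lt2_wf K) (fun _ => tm2 reduced2) pi2_body.

Definition pi_tm2 : tm2 X -> tm2 reduced2 := map2 pi2.

Definition reduction : polygraph3 :=
  @Polygraph3 reduced2 {x : C3 X | collapse3 K x = None /\ ~ redundant3 x}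
    (fun a => pi_tm2 (s2 (proj1_sig a))) (fun a => pi_tm2 (t2 (proj1_sig a))).

Lemma pi1_eq x : pi1 x = pi1_body (fun y (_ : lt1 K y x) => pi1 y).
Proof.
unfold pi1; rewrite Fix_eq; [reflexivity|].
intros y r r' E; assert (r = r') as ->; [|reflexivity].
do 2 (apply functional_extensionality_dep; intro); apply E.
Qed.

Lemma pi2_eq x : pi2 x = pi2_body (fun y (_ : lt2 K y x) => pi2 y).
Proof.
unfold pi2; rewrite Fix_eq; [reflexivity|].
intros y r r' E; assert (r = r') as ->; [|reflexivity].
do 2 (apply functional_extensionality_dep; intro); apply E.
Qed.

Lemma map2_ext h h' f :
  (forall a, occ2 a f -> h a = h' a) -> map2 h f = map2 h' f.
Proof.
induction f as [a|u|f IHf g IHg|f IHf g IHg|f IHf]; simpl; intros E; auto.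
- rewrite IHf, IHg; auto.
- rewrite IHf, IHg; auto.
- rewrite IHf; auto.
Qed.

Lemma pi1_redundant c u x :
  collapse2 K c = Some (u, x) -> pi1 x = flat_map pi1 (letters u).
Proof.
intros E; rewrite pi1_eq; unfold pi1_body.
destruct (choose_or _) as [[u' [c' E']]|n]; [|destruct n; eauto].
pose proof (collapse2_inj E E'); subst c'.
assert (u' = u) by congruence; subst u'.
rewrite !flat_map_concat_map; f_equal; apply map_ext_in; intros y Hy.
destruct (excluded_middle_informative _) as [|n]; [reflexivity|].
destruct n; eapply collapse2_lt; eauto.
Qed.

Lemma pi1_kept x (h : ~ redundant1 x) : pi1 x = [exist _ x h].
Proof.
rewrite pi1_eq; unfold pi1_body.
destruct (choose_or _) as [[u' [c' E']]|n].
- destruct h; exists u', c'; exact E'.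
- rewrite (proof_irrelevance _ n h); reflexivity.
Qed.

Lemma pi2_redundant c f x :
  collapse3 K c = Some (f, x) -> pi2 x = pi_tm2 f.
Proof.
intros E; rewrite pi2_eq; unfold pi2_body.
destruct (excluded_middle_informative _) as [h|_].
{ exfalso; apply (proj2 h); exists f, c; exact E. }
destruct (choose_or _) as [[f' [c' E']]|n]; [|destruct n; eauto].
pose proof (collapse3_inj E E'); subst c'.
assert (f' = f) by congruence; subst f'.
apply map2_ext; intros y Hy.
destruct (excluded_middle_informative _) as [|n]; [reflexivity|].
destruct n; eapply collapse3_lt; eauto.
Qed.

Lemma pi2_collapsed x u y :
  collapse2 K x = Some (u, y) -> pi2 x = Id2 (P := reduced2) (pi_word u).
Proof.
intros E; rewrite pi2_eq; unfold pi2_body.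
destruct (excluded_middle_informative _) as [h|_].
{ exfalso; pose proof (proj1 h); congruence. }
destruct (choose_or _) as [[f [c E']]|_].
- pose proof (collapse2_not_redundant E'); congruence.
- rewrite E; reflexivity.
Qed.

Lemma pi2_kept x (h : kept2 x) : pi2 x = Gen2 (P := reduced2) (exist _ x h).
Proof.
rewrite pi2_eq; unfold pi2_body.
destruct (excluded_middle_informative _) as [h'|n]; [|destruct n; exact h].
rewrite (proof_irrelevance _ h' h); reflexivity.
Qed.

End Reduction.

(* Main.v *)
(** Squier's theorem: in a terminating 2-polygraph whose critical branchings are
    joined modulo a congruence, all branchings are, so by well-founded induction
    any two positive 2-cells [p_u] from [u] to a normal form are congruent; then
    [f . p_v = p_u] for every zigzag [f : u => v], by induction on [f], hence
    parallel zigzags are congruent.  This applies to the union of the stages of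
    the completion, because a critical branching of the union is already
    critical at some finite stage.  The adjoined 2-cells do not change the
    presented category, by induction on their stage.

    The reduction is a functor [pi] that identifies the boundaries of all the
    3-cells of the completion, the removed ones included.  Using the collapsed
    2-cells, every word [u] is linked to the word [pi u], seen as a word on the
    kept generators, by a 2-cell that [pi] sends to an identity.  Conjugating by
    these 2-cells lifts every 2-cell of the reduced polygraph to the completion,
    where parallel 2-cells are congruent; projecting back by [pi] gives the
    coherence of the reduction. *)

From Stdlib Require Import List FinFun Classical ClassicalEpsilon Wf_nat Lia.
From Stdlib Require Import FunctionalExtensionality PropExtensionality.
Require Import Defs.
Import ListNotations.

Set Implicit Arguments.
Unset Strict Implicit.
Unset Printing Implicit Defensive.

(* The start of a concatenation or of an empty word computes, so composability conditions with such
   a right-hand side reduce without rewriting; [stop] needs [stop_wcat] instead. *)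
Local Hint Extern 1 (_ = start _) => progress cbn [start wcat id1] : core.

(** * Free 2-cells *)

Section FreeCells.
Variable P : polygraph2.
Implicit Types (u v w : word P) (f g h k : tm2 P).

(** Identities carry their word and every other constructor computes its boundary from those of its
    parts. This is how existentially quantified boundaries are matched later on. *)
Lemma cell2_unique u v f :
  cell2 u v f -> forall u' v', cell2 u' v' f -> u = u' /\ v = v'.
Proof.
induction 1 as [a|u Hu|u v u' v' f g _ IHf _ IHg E|u v w f g _ IHf _ IHg|
  u v f _ IH]; intros x y H; inversion H; subst; auto.
- edestruct IHf, IHg; eauto; subst; auto.
- edestruct IHf, IHg; eauto; subst; auto.
- edestruct IH; eauto.
Qed.

Lemma cell2_congr u v f : cell2 u v f -> congr u v.
Proof. induction 1; eauto using congr. Qed.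

Lemma congr_cell2 u v : congr u v -> exists f, cell2 u v f.
Proof.
induction 1 as [a|u Hu|u v _ [f Hf]|u v w _ [f Hf] _ [g Hg]|
  u u' v v' _ [f Hf] _ [g Hg] E]; eauto using cell2.
Qed.

Lemma eq2_mono (E E' : tm2 P -> tm2 P -> Prop) u v f g :
  (forall f g, E f g -> E' f g) -> eq2 E u v f g -> eq2 E' u v f g.
Proof. intros HE; induction 1; eauto using eq2. Qed.

Lemma eq2_free E u v f g : eq2 (@free2 P) u v f g -> eq2 E u v f g.
Proof. apply eq2_mono; intros ? ? []. Qed.

Hypothesis HP : is_polygraph2 P.

Lemma congr_boundary u v : congr u v -> cell1 u /\ cell1 v /\ parallel1 u v.
Proof.
unfold parallel1.
induction 1 as [a|u Hu|u v _ IH|u v w _ IH _ IH'|u u' v v' _ IH _ IH' E].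
- apply HP.
- auto.
- intuition.
- intuition congruence.
- assert (stop u' = start v') by intuition congruence.
  rewrite !stop_wcat by auto; simpl.
  intuition (auto using cell1_wcat).
Qed.

Lemma cell2_boundary u v f : cell2 u v f -> cell1 u /\ cell1 v /\ parallel1 u v.
Proof. eauto using congr_boundary, cell2_congr. Qed.

Lemma cell2_src u v f : cell2 u v f -> cell1 u.
Proof. intros H; apply (cell2_boundary H). Qed.

Lemma cell2_tgt u v f : cell2 u v f -> cell1 v.
Proof. intros H; apply (cell2_boundary H). Qed.

Lemma cell2_stop u v f : cell2 u v f -> stop u = stop v.
Proof. intros H; apply (cell2_boundary H). Qed.

Lemma cell2_start u v f : cell2 u v f -> start u = start v.
Proof. intros H; apply (cell2_boundary H). Qed.

Lemma cell2_composable u v u' v' f g :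
  cell2 u v f -> cell2 u' v' g -> stop u = start u' -> stop v = start v'.
Proof.
intros Hf Hg; rewrite (cell2_stop Hf), (cell2_start Hg); auto.
Qed.

(** The delicate laws are associativity and units of horizontal composition: there the boundary of
    one side has the required form only after rewriting words by the corresponding law of
    concatenation. *)
Lemma eq2_cell2 E u v f g : eq2 E u v f g -> cell2 u v f /\ cell2 u v g.
Proof.
induction 1 as [| | | |? ? ? ? ? ? ? ? ? [] ? []|? ? ? ? ? ? ? ? [] ? []
  |? ? ? ? ? []| | | | | | | |u v f H|u v Hu Hv|u v w u' v' w' f g f' g' H H0 H1 H2];
  repeat match goal with H : _ /\ _ |- _ => destruct H end;
  try (split; solve [eauto using cell2, cell2_src, cell2_tgt]).
- split.
  + rewrite <- !wcat_assoc; repeat constructor; auto.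
    rewrite stop_wcat; auto.
  + repeat constructor; auto.
- split; auto.
  rewrite <- (id1_wcat u), <- (id1_wcat v), <- (cell2_start H) at 1.
  repeat constructor; auto.
- split; auto.
  rewrite <- (wcat_id1 u (stop u)), <- (wcat_id1 v (stop u)) at 1.
  repeat constructor; auto.
- split; repeat constructor; auto using cell1_wcat.
- split; [apply cell2_comp0; eauto using cell2|].
  eapply cell2_comp1; apply cell2_comp0; eauto using cell2_composable.
Qed.

Variable E : tm2 P -> tm2 P -> Prop.

Lemma eq2_cast u v u' v' f g :
  eq2 E u v f g -> u = u' -> v = v' -> eq2 E u' v' f g.
Proof. intros H <- <-; exact H. Qed.

Lemma eq2_comp1_l u v w f f' g :
  eq2 E u v f f' -> cell2 v w g -> eq2 E u w (Comp1 f g) (Comp1 f' g).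
Proof. eauto using eq2. Qed.

Lemma eq2_comp1_r u v w f g g' :
  cell2 u v f -> eq2 E v w g g' -> eq2 E u w (Comp1 f g) (Comp1 f g').
Proof. eauto using eq2. Qed.

Lemma eq2_assoc1_r u v w x f g h :
  cell2 u v f -> cell2 v w g -> cell2 w x h ->
  eq2 E u x (Comp1 f (Comp1 g h)) (Comp1 (Comp1 f g) h).
Proof. eauto using eq2. Qed.

Lemma eq2_cancel_r u v w f g h :
  cell2 u v f -> cell2 u v g -> cell2 v w h ->
  eq2 E u w (Comp1 f h) (Comp1 g h) -> eq2 E u v f g.
Proof.
assert (K : forall f, cell2 u v f -> cell2 v w h ->
  eq2 E u v (Comp1 (Comp1 f h) (Inv2 h)) f).
{ intros k Hk Hh.
  eapply eq2_trans; [eapply eq2_assoc1; eauto using cell2|].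
  eapply eq2_trans; [eapply eq2_comp1_r; [eassumption|eapply eq2_invr; eauto]|].
  apply eq2_idr1; auto. }
intros Hf Hg Hh H.
eapply eq2_trans; [apply eq2_sym, K; auto|].
eapply eq2_trans; [|apply K; auto].
eapply eq2_comp1_l; eauto using cell2.
Qed.

Lemma eq2_cancel_l u v w f g h :
  cell2 v w f -> cell2 v w g -> cell2 u v h ->
  eq2 E u w (Comp1 h f) (Comp1 h g) -> eq2 E v w f g.
Proof.
assert (K : forall f, cell2 v w f -> cell2 u v h ->
  eq2 E v w (Comp1 (Inv2 h) (Comp1 h f)) f).
{ intros k Hk Hh.
  eapply eq2_trans; [eapply eq2_assoc1_r; eauto using cell2|].
  eapply eq2_trans; [eapply eq2_comp1_l; [eapply eq2_invl; eauto|eassumption]|].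
  apply eq2_idl1; auto. }
intros Hf Hg Hh H.
eapply eq2_trans; [apply eq2_sym, K; auto|].
eapply eq2_trans; [|apply K; auto].
eapply eq2_comp1_r; eauto using cell2.
Qed.

(** With its mirror image below, this sequentialises a horizontal composite in either order;
    comparing the two orders closes Peiffer branchings. *)
Lemma eq2_interchange_l u v u' v' f g :
  cell2 u v f -> cell2 u' v' g -> stop u = start u' ->
  eq2 E (wcat u u') (wcat v v')
    (Comp1 (Comp0 f (Id2 u')) (Comp0 (Id2 v) g)) (Comp0 f g).
Proof.
intros Hf Hg Es.
assert (cell2 v v (Id2 v)) by eauto using cell2, cell2_tgt.
assert (cell2 u' u' (Id2 u')) by eauto using cell2, cell2_src.
eapply eq2_trans; [apply eq2_sym; eapply eq2_exchange; eauto|].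
apply eq2_comp0; auto using eq2_idl1, eq2_idr1.
Qed.

Lemma eq2_interchange_r u v u' v' f g :
  cell2 u v f -> cell2 u' v' g -> stop u = start u' ->
  eq2 E (wcat u u') (wcat v v')
    (Comp1 (Comp0 (Id2 u) g) (Comp0 f (Id2 v'))) (Comp0 f g).
Proof.
intros Hf Hg Es.
assert (cell2 u u (Id2 u)) by eauto using cell2, cell2_src.
assert (cell2 v' v' (Id2 v')) by eauto using cell2, cell2_tgt.
eapply eq2_trans; [apply eq2_sym; eapply eq2_exchange; eauto|].
apply eq2_comp0; auto using eq2_idl1, eq2_idr1.
Qed.

(** * Whiskering of 2-cells by words *)

Definition whisker_tm w f w' : tm2 P := Comp0 (Id2 w) (Comp0 f (Id2 w')).

Lemma cell2_whisker w u v f w' :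
  cell1 w -> cell2 u v f -> cell1 w' -> stop w = start u -> stop u = start w' ->
  cell2 (wcat w (wcat u w')) (wcat w (wcat v w')) (whisker_tm w f w').
Proof. intros; repeat apply cell2_comp0; auto using cell2_id, cell2_comp0, cell2_inv. Qed.

Lemma eq2_whisker w u v f g w' :
  cell1 w -> eq2 E u v f g -> cell1 w' -> stop w = start u -> stop u = start w' ->
  eq2 E (wcat w (wcat u w')) (wcat w (wcat v w'))
    (whisker_tm w f w') (whisker_tm w g w').
Proof. intros; repeat apply eq2_comp0; auto using eq2_refl, cell2_id. Qed.

Lemma eq2_whisker_id w u w' :
  cell1 w -> cell1 u -> cell1 w' -> stop w = start u -> stop u = start w' ->
  eq2 E (wcat w (wcat u w')) (wcat w (wcat u w'))
    (whisker_tm w (Id2 u) w') (Id2 (wcat w (wcat u w'))).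
Proof.
intros; eapply eq2_trans; [|apply eq2_id0; auto using cell1_wcat].
apply eq2_comp0; auto using eq2_id0, eq2_refl, cell2_id.
Qed.

Lemma eq2_whisker_comp1 w u v x f g w' :
  cell1 w -> cell2 u v f -> cell2 v x g -> cell1 w' ->
  stop w = start u -> stop u = start w' ->
  eq2 E (wcat w (wcat u w')) (wcat w (wcat x w'))
    (whisker_tm w (Comp1 f g) w')
    (Comp1 (whisker_tm w f w') (whisker_tm w g w')).
Proof.
intros Hw Hf Hg Hw' Es Es'.
assert (Ew : cell2 w w (Id2 w)) by auto using cell2_id, cell2_comp0, cell2_inv.
assert (Ew' : cell2 w' w' (Id2 w')) by auto using cell2_id, cell2_comp0, cell2_inv.
assert (Ev : stop v = start w') by (rewrite <- (cell2_stop Hf); auto).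
assert (Ev' : stop w = start v) by (rewrite <- (cell2_start Hf); auto).
eapply eq2_trans; [|eapply eq2_exchange; eauto using cell2].
apply eq2_comp0; auto; [apply eq2_sym, eq2_idl1; auto|].
eapply eq2_trans; [|eapply eq2_exchange; eauto using cell2].
apply eq2_comp0; eauto using eq2_refl, cell2, eq2_sym, eq2_idl1.
Qed.

Lemma id1_wcat_start x u : x = start u -> wcat (id1 x) u = u.
Proof. intros ->; apply id1_wcat. Qed.

Lemma eq2_whisker_unit_l u v f w x :
  cell2 u v f -> cell1 w -> stop u = start w -> x = start u ->
  eq2 E (wcat u w) (wcat v w) (whisker_tm (id1 x) f w) (Comp0 f (Id2 w)).
Proof.
intros Hf Hw Es ->; apply (@eq2_idl0 P E (wcat u w) (wcat v w) (Comp0 f (Id2 w))).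
apply cell2_comp0; auto using cell2_id.
Qed.

Lemma eq2_whisker_unit_r u v f w x :
  cell2 u v f -> cell1 w -> stop w = start u -> x = stop u ->
  eq2 E (wcat w u) (wcat w v) (whisker_tm w f (id1 x)) (Comp0 (Id2 w) f).
Proof.
intros Hf Hw Es ->; apply eq2_comp0; auto using eq2_refl, cell2_id, eq2_idr0.
Qed.

Lemma eq2_whisker_unit u v f x y :
  cell2 u v f -> x = start u -> y = stop u ->
  eq2 E u v (whisker_tm (id1 x) f (id1 y)) f.
Proof.
intros Hf -> ->; eapply eq2_trans; [|apply eq2_idr0; auto].
apply (@eq2_idl0 P E u v (Comp0 f (Id2 (id1 (stop u))))).
rewrite <- (wcat_id1 u (stop u)), <- (wcat_id1 v (stop u)) at 1.
apply cell2_comp0; auto; repeat constructor.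
Qed.

Lemma eq2_whisker_whisker w l u v f r w' :
  cell1 w -> cell1 l -> cell2 u v f -> cell1 r -> cell1 w' ->
  stop w = start l -> stop l = start u -> stop u = start r -> stop r = start w' ->
  eq2 E (wcat (wcat w l) (wcat u (wcat r w')))
        (wcat (wcat w l) (wcat v (wcat r w')))
    (whisker_tm w (whisker_tm l f r) w') (whisker_tm (wcat w l) f (wcat r w')).
Proof.
intros Hw Hl Hf Hr Hw' E1 E2 E3 E4; unfold whisker_tm.
assert (Iw : cell2 w w (Id2 w)) by auto using cell2_id, cell2_comp0, cell2_inv.
assert (Iw' : cell2 w' w' (Id2 w')) by auto using cell2_id, cell2_comp0, cell2_inv.
assert (Il : cell2 l l (Id2 l)) by auto using cell2_id, cell2_comp0, cell2_inv.
assert (Ir : cell2 r r (Id2 r)) by auto using cell2_id, cell2_comp0, cell2_inv.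
assert (E5 : stop (wcat u r) = start w') by (rewrite stop_wcat; auto).
assert (E6 : stop u = start (wcat r w')) by auto.
assert (E7 : stop l = start (wcat u (wcat r w'))) by auto.
assert (Irw : cell2 (wcat r w') (wcat r w') (Id2 (wcat r w')))
  by auto using cell2_id, cell2_comp0, cell2_inv, cell1_wcat.
(* In the intermediate term the right contexts [r] and [w'] are already merged while the left
   contexts [w] and [l] are still nested. *)
eapply eq2_trans with (g := Comp0 (Id2 w) (Comp0 (Id2 l) (Comp0 f (Id2 (wcat r w'))))).
- rewrite !wcat_assoc; apply eq2_comp0; auto using eq2_refl.
  eapply eq2_trans.
  + eapply eq2_cast; [apply (@eq2_assoc0 P E l l (wcat u r) (wcat v r) w' w')|..];
      auto using cell2_comp0; rewrite !wcat_assoc; reflexivity.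
  + apply eq2_comp0; auto using eq2_refl.
    eapply eq2_trans; [apply eq2_assoc0; auto|].
    apply eq2_comp0; auto using eq2_refl, eq2_id0.
- eapply eq2_trans.
  + eapply eq2_cast; [apply eq2_sym, (@eq2_assoc0 P E w w l l
      (wcat u (wcat r w')) (wcat v (wcat r w')))|..];
      auto using cell2_comp0; rewrite !wcat_assoc; reflexivity.
  + apply eq2_comp0; auto using eq2_id0, eq2_refl, cell2_comp0.
    rewrite stop_wcat; auto.
Qed.

End FreeCells.

(** * Rewriting paths *)

Section Steps.
Variable P : polygraph2.
Hypothesis HP : is_polygraph2 P.
Variable E : tm2 P -> tm2 P -> Prop.
Implicit Types (s : step P) (u v w : word P) (f g h p q : tm2 P).
Notation is_step := (is_step (@all2 P)).

Lemma cell2_step s : is_step s -> cell2 (step_src s) (step_tgt s) (step_tm s).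
Proof.
intros (_ & Hl & Hr & E1 & E2); apply cell2_whisker; auto using cell2_gen.
Qed.

Lemma is_step_whisker w s w' :
  is_step s -> cell1 w -> cell1 w' -> stop w = start (step_src s) ->
  stop (step_src s) = start w' -> is_step (whisker w s w').
Proof.
intros (_ & Hl & Hr & E1 & E2) Hw Hw' E3 E4; unfold step_src in *; simpl in E3.
rewrite !stop_wcat in E4 by auto.
repeat split; simpl; auto using cell1_wcat.
rewrite stop_wcat; auto.
Qed.

Lemma step_src_whisker w s w' :
  step_src (whisker w s w') = wcat w (wcat (step_src s) w').
Proof. unfold step_src; simpl; rewrite !wcat_assoc; reflexivity. Qed.

Lemma step_tgt_whisker w s w' :
  step_tgt (whisker w s w') = wcat w (wcat (step_tgt s) w').
Proof. unfold step_tgt; simpl; rewrite !wcat_assoc; reflexivity. Qed.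

Lemma step_tm_whisker w s w' :
  is_step s -> cell1 w -> cell1 w' -> stop w = start (step_src s) ->
  stop (step_src s) = start w' ->
  eq2 E (wcat w (wcat (step_src s) w')) (wcat w (wcat (step_tgt s) w'))
    (whisker_tm w (step_tm s) w') (step_tm (whisker w s w')).
Proof.
intros (_ & Hl & Hr & E1 & E2) Hw Hw' E3 E4; unfold step_src in E3, E4.
simpl in E3; rewrite !stop_wcat in E4 by auto.
eapply eq2_cast; [eapply eq2_whisker_whisker with (r := rctx s) (l := lctx s);
  eauto using cell2_gen|..]; unfold step_src, step_tgt;
  rewrite !wcat_assoc; reflexivity.
Qed.

Definition gen_step (a : C2 P) : step P :=
  Step (id1 (start (s1 a))) a (id1 (stop (s1 a))).

Lemma is_step_gen a : is_step (gen_step a).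
Proof. repeat split. Qed.

Lemma step_src_gen a : step_src (gen_step a) = s1 a.
Proof. unfold step_src; simpl; rewrite wcat_id1, id1_wcat; reflexivity. Qed.

Lemma step_tgt_gen a : step_tgt (gen_step a) = t1 a.
Proof.
unfold step_tgt; simpl; rewrite wcat_id1, (proj1 (proj2 (proj2 (HP a)))).
apply id1_wcat.
Qed.

Lemma step_tm_gen a : eq2 E (s1 a) (t1 a) (step_tm (gen_step a)) (Gen2 a).
Proof. apply eq2_whisker_unit; auto using cell2_gen. Qed.

(** A normal shape for positive 2-cells: a right-nested composite of rewriting steps ending in an
    identity. It allows induction along a rewriting sequence and inspection of the first step. *)
Inductive path : word P -> word P -> tm2 P -> Prop :=
| path_id u : cell1 u -> path u u (Id2 u)
| path_step s v f :
    is_step s -> path (step_tgt s) v f ->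
    path (step_src s) v (Comp1 (step_tm s) f).

Lemma path_cell2 u v f : path u v f -> cell2 u v f.
Proof. induction 1; eauto using cell2, cell2_step. Qed.

Lemma path_comp1 u v w f g :
  path u v f -> path v w g ->
  exists h, path u w h /\ eq2 E u w h (Comp1 f g).
Proof.
intros Hf Hg; induction Hf as [u Hu|s v f Hs Hf IH].
- exists g; split; auto using eq2_sym, eq2_idl1, path_cell2.
- destruct (IH Hg) as (h & Hh & Eh).
  exists (Comp1 (step_tm s) h); split; [constructor; auto|].
  eapply eq2_trans; [eapply eq2_comp1_r; eauto using cell2_step|].
  eapply eq2_assoc1_r; eauto using cell2_step, path_cell2.
Qed.

Lemma path_whisker w u v f w' :
  path u v f -> cell1 w -> cell1 w' -> stop w = start u -> stop u = start w' ->
  exists h, path (wcat w (wcat u w')) (wcat w (wcat v w')) h /\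
    eq2 E (wcat w (wcat u w')) (wcat w (wcat v w')) h (whisker_tm w f w').
Proof.
intros Hf Hw Hw'; induction Hf as [u Hu|s v f Hs Hf IH]; intros E1 E2.
- exists (Id2 (wcat w (wcat u w'))); split.
  + constructor; apply cell1_wcat; auto using cell1_wcat.
  + apply eq2_sym, eq2_whisker_id; auto.
- pose proof (cell2_step Hs) as Hs'.
  destruct IH as (h & Hh & Eh).
  { rewrite <- (cell2_start HP Hs'); auto. }
  { rewrite <- (cell2_stop HP Hs'); auto. }
  exists (Comp1 (step_tm (whisker w s w')) h); split.
  + rewrite <- step_src_whisker; constructor; auto using is_step_whisker.
    rewrite step_tgt_whisker; auto.
  + eapply eq2_trans; [|apply eq2_sym; eapply eq2_whisker_comp1;
      eauto using path_cell2].
    eapply eq2_comp1; eauto using eq2_sym, step_tm_whisker.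
Qed.

Lemma path_whisker_l w u v f :
  path u v f -> cell1 w -> stop w = start u ->
  exists h, path (wcat w u) (wcat w v) h /\
    eq2 E (wcat w u) (wcat w v) h (Comp0 (Id2 w) f).
Proof.
intros Hf Hw Es.
destruct (@path_whisker w u v f (id1 (stop u)) Hf) as (h & Hh & Eh);
  auto; [exact I|].
rewrite !wcat_id1 in *; exists h; split; auto.
eapply eq2_trans; [exact Eh|apply eq2_whisker_unit_r; auto using path_cell2].
Qed.

Lemma path_whisker_r w u v f :
  path u v f -> cell1 w -> stop u = start w ->
  exists h, path (wcat u w) (wcat v w) h /\
    eq2 E (wcat u w) (wcat v w) h (Comp0 f (Id2 w)).
Proof.
intros Hf Hw Es.
destruct (@path_whisker (id1 (start u)) u v f w Hf) as (h & Hh & Eh);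
  auto; [exact I|].
rewrite !id1_wcat_start in * by
  (simpl; auto; apply (cell2_start HP (path_cell2 Hf))).
exists h; split; auto.
eapply eq2_trans; [exact Eh|apply eq2_whisker_unit_l; auto using path_cell2].
Qed.

(** The only constructor that is not sequential is the horizontal composite, and interchange
    replaces it by two whiskered paths in a row. *)
Lemma positive_path u v f :
  cell2 u v f -> positive f -> exists h, path u v h /\ eq2 E u v h f.
Proof.
induction 1 as [a|u Hu|u v u' v' f g Hf IHf Hg IHg Es|u v w f g Hf IHf Hg IHg|];
  simpl; intros Hpos.
- exists (Comp1 (step_tm (gen_step a)) (Id2 (t1 a))); split.
  + rewrite <- (step_src_gen a); constructor; [apply is_step_gen|].
    rewrite step_tgt_gen; constructor; apply HP.
  + eapply eq2_trans; [|apply step_tm_gen].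
    apply eq2_idr1; apply (eq2_cell2 HP (step_tm_gen a)).
- exists (Id2 u); split; [constructor; auto|auto using eq2_refl, cell2_id].
- destruct IHf as (f' & Hf' & Ef); [tauto|].
  destruct IHg as (g' & Hg' & Eg); [tauto|].
  (* The left factor is rewritten first, next to the source of [g]; the right factor follows, next
     to the target of [f]. *)
  destruct (path_whisker_r Hf' (cell2_src HP Hg) Es) as (h & Hh & Eh).
  destruct (path_whisker_l Hg' (cell2_tgt HP Hf)) as (k & Hk & Ek).
  { rewrite <- (cell2_stop HP Hf); auto. }
  destruct (path_comp1 Hh Hk) as (l & Hl & El).
  exists l; split; auto.
  eapply eq2_trans; [exact El|].
  eapply eq2_trans; [eapply eq2_comp1; eauto|].
  eapply eq2_trans; [eapply eq2_interchange_l; eauto using path_cell2|].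
  apply eq2_comp0; auto.
- destruct IHf as (f' & Hf' & Ef); [tauto|].
  destruct IHg as (g' & Hg' & Eg); [tauto|].
  destruct (path_comp1 Hf' Hg') as (h & Hh & Eh).
  exists h; split; auto.
  eapply eq2_trans; [exact Eh|eapply eq2_comp1; eauto].
- contradiction.
Qed.

End Steps.

(** * Squier's theorem *)

Section Squier.
Variable P : polygraph2.
Hypothesis HP : is_polygraph2 P.
Variable E : tm2 P -> tm2 P -> Prop.
Implicit Types (s : step P) (u v w : word P) (p q : tm2 P).
Notation is_step := (is_step (@all2 P)).
Notation normal := (normal_form (@all2 P)).

Definition joined s s' : Prop :=
  exists w p q, cell2 (step_tgt s) w p /\ positive p /\
    cell2 (step_tgt s') w q /\ positive q /\
    eq2 E (step_src s) w (Comp1 (step_tm s) p) (Comp1 (step_tm s') q).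

Lemma joined_sym s s' : step_src s = step_src s' -> joined s s' -> joined s' s.
Proof.
intros Es (w & p & q & H); exists w, q, p; rewrite <- Es.
intuition auto using eq2_sym.
Qed.

Lemma joined_refl s : is_step s -> joined s s.
Proof.
intros Hs; pose proof (cell2_step Hs) as Cs.
pose proof (cell2_tgt HP Cs).
exists (step_tgt s), (Id2 (step_tgt s)), (Id2 (step_tgt s)); repeat split;
  auto using cell2_id; eapply eq2_refl; eauto using cell2.
Qed.

Lemma joined_whisker w s s' w' :
  local_branching (@all2 P) s s' -> cell1 w -> cell1 w' ->
  stop w = start (step_src s) -> stop (step_src s) = start w' ->
  joined s s' -> joined (whisker w s w') (whisker w s' w').
Proof.
intros (Hs & Hs' & Es) Hw Hw' E1 E2 (x & p & q & Hp & Pp & Hq & Pq & H).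
pose proof (cell2_step Hs) as Cs; pose proof (cell2_step Hs') as Cs'.
assert (E1' : stop w = start (step_src s')) by congruence.
assert (E2' : stop (step_src s') = start w') by congruence.
assert (F1 : stop w = start (step_tgt s)) by (rewrite <- (cell2_start HP Cs); auto).
assert (F2 : stop (step_tgt s) = start w') by (rewrite <- (cell2_stop HP Cs); auto).
assert (F1' : stop w = start (step_tgt s')) by (rewrite <- (cell2_start HP Cs'); auto).
assert (F2' : stop (step_tgt s') = start w') by (rewrite <- (cell2_stop HP Cs'); auto).
exists (wcat w (wcat x w')), (whisker_tm w p w'), (whisker_tm w q w').
rewrite !step_tgt_whisker, step_src_whisker.
repeat split; auto using cell2_whisker.
(* Whiskering distributes over a step followed by its closing 2-cell. This is applied to both sides
   of the square. *)
assert (K : forall s p, is_step s -> cell2 (step_tgt s) x p ->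
  step_src s = step_src s' ->
  eq2 E (wcat w (wcat (step_src s) w')) (wcat w (wcat x w'))
    (whisker_tm w (Comp1 (step_tm s) p) w')
    (Comp1 (step_tm (whisker w s w')) (whisker_tm w p w'))).
{ intros s2 p2 Hs2 Hp2 Es2; pose proof (cell2_step Hs2) as Cs2.
  eapply eq2_trans; [eapply eq2_whisker_comp1; eauto; congruence|].
  eapply eq2_comp1_l; [apply step_tm_whisker; auto; congruence|].
  apply cell2_whisker; auto.
  - rewrite <- (cell2_start HP Cs2); congruence.
  - rewrite <- (cell2_stop HP Cs2); congruence. }
eapply eq2_trans; [apply eq2_sym, K; auto|].
eapply eq2_trans; [eapply eq2_whisker; eauto|].
rewrite Es; apply K; auto.
Qed.

(** Each step is closed by the other one, whiskered by a target. The square commutes by the exchange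
    law alone, whatever [E] is. *)
Lemma peiffer_joined s s' : peiffer_form (@all2 P) s s' -> joined s s'.
Proof.
intros (f & g & Hf & Hg & Es & -> & ->).
pose proof (cell2_step Hf) as Cf; pose proof (cell2_step Hg) as Cg.
destruct (cell2_boundary HP Cf) as (B1 & B2 & B3 & B4).
destruct (cell2_boundary HP Cg) as (B5 & B6 & B7 & B8).
assert (Et : stop (step_tgt f) = start (step_tgt g)) by congruence.
exists (wcat (step_tgt f) (step_tgt g)),
  (Comp0 (Id2 (step_tgt f)) (step_tm g)), (Comp0 (step_tm f) (Id2 (step_tgt g))).
rewrite !step_tgt_whisker, step_src_whisker, !wcat_id1, !id1_wcat_start by auto.
repeat split.
- apply cell2_comp0; auto using cell2_id; congruence.
- apply cell2_comp0; auto using cell2_id; congruence.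
- assert (K1 : eq2 E (wcat (step_src f) (step_src g)) (wcat (step_tgt f) (step_src g))
    (step_tm (whisker (id1 (start (step_src f))) f (step_src g)))
    (Comp0 (step_tm f) (Id2 (step_src g)))).
  { eapply eq2_trans; [|eapply eq2_whisker_unit_l; eauto].
    apply eq2_sym; eapply eq2_cast; [apply step_tm_whisker; auto|..];
      try exact I; apply id1_wcat_start; auto. }
  assert (K2 : eq2 E (wcat (step_src f) (step_src g)) (wcat (step_src f) (step_tgt g))
    (step_tm (whisker (step_src f) g (id1 (stop (step_src g)))))
    (Comp0 (Id2 (step_src f)) (step_tm g))).
  { eapply eq2_trans; [|eapply eq2_whisker_unit_r; eauto].
    apply eq2_sym; eapply eq2_cast; [apply step_tm_whisker; auto|..];
      try exact I; rewrite wcat_id1; auto. }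
  eapply eq2_trans; [eapply eq2_comp1_l; [exact K1|]|].
  { apply cell2_comp0; auto using cell2_id; congruence. }
  eapply eq2_trans; [apply eq2_interchange_l; auto|].
  eapply eq2_trans; [apply eq2_sym, eq2_interchange_r; auto|].
  eapply eq2_comp1_l; [apply eq2_sym, K2|].
  apply cell2_comp0; auto using cell2_id; congruence.
Qed.

Hypothesis Hcrit : forall s s', critical (@all2 P) s s' -> joined s s'.

(** Induction on the size of the context of [s]: an overlap that is not critical is a whiskering of
    a different overlap, and being joined is stable under whiskering. *)
Lemma overlap_joined n s s' :
  length (letters (lctx s)) + length (letters (rctx s)) < n ->
  overlap (@all2 P) s s' -> joined s s'.
Proof.
revert s s'; induction n as [|n IH]; intros s s' Hn Ho; [lia|].
destruct (classic (critical (@all2 P) s s')) as [Hc|Hc]; auto.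
apply not_and_or in Hc as [Hc|Hc]; [contradiction|].
apply not_all_ex_not in Hc as (f & Hc).
apply not_all_ex_not in Hc as (g & Hc).
apply imply_to_and in Hc as (Hfg & Hc).
apply imply_to_and in Hc as (Hi & Hc).
destruct Hi as (w & w' & Hw & Hw' & E1 & E2 & -> & ->).
apply joined_whisker; auto; [apply Hfg|].
apply IH; auto.
simpl in Hn; rewrite !length_app in Hn.
(* If one whiskering word has a letter, the context of [f] is strictly smaller. If both are empty,
   the included branching is the given one, against the choice of [f] and [g]. *)
destruct w as [x [|a l]], w' as [y [|b m]]; simpl in Hn; try lia.
destruct Hc; unfold stop in E1; simpl in E1; subst x.
destruct Hfg as ((_ & _ & Es) & _).
destruct f as [fl fr fR], g as [gl gr gR]; unfold whisker; simpl.
change (Word (G := P) y []) with (id1 (G := P) y).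
change (Word (G := P) (start fl) []) with (id1 (G := P) (start fl)).
rewrite (wcat_id1 fR y), (wcat_id1 gR y).
split; f_equal; symmetry; apply id1_wcat_start; auto.
unfold step_src in Es; simpl in *; injection Es; auto.
Qed.

Lemma local_joined s s' : local_branching (@all2 P) s s' -> joined s s'.
Proof.
intros Hl.
destruct (classic (s = s')) as [<-|Hn]; [apply joined_refl, Hl|].
destruct (classic (peiffer_form (@all2 P) s s')); [apply peiffer_joined; auto|].
destruct (classic (peiffer_form (@all2 P) s' s)).
{ apply joined_sym; [symmetry; apply Hl|apply peiffer_joined; auto]. }
eapply overlap_joined; [auto|]; repeat split; auto; apply Hl.
Qed.

(** * Normal forms and their paths modulo [E] *)

Variable R : word P -> word P -> Prop.
Hypothesis R_wf : well_founded R.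
Hypothesis R_trans : forall u v w, R u v -> R v w -> R u w.
Hypothesis R_step : forall s, is_step s -> R (step_tgt s) (step_src s).

Lemma path_decreasing u v p : path u v p -> u = v \/ R v u.
Proof.
induction 1 as [u Hu|s v p Hs Hp [<-|IH]]; eauto.
Qed.

Lemma path_normal u v p : path u v p -> normal u -> v = u /\ p = Id2 u.
Proof.
intros Hp Hu; destruct Hp as [|s v p Hs Hp]; auto.
destruct (proj2 Hu s Hs eq_refl).
Qed.

(** Newman's lemma with 2-cells kept track of. Two paths out of [u] begin with steps forming a local
    branching; its closing square, together with uniqueness at the targets of both steps, makes the
    paths equal modulo [E]. *)
Lemma normalize u : cell1 u -> exists v p, normal v /\ path u v p /\
  forall w q, normal w -> path u w q -> w = v /\ eq2 E u v q p.
Proof.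
induction (R_wf u) as [u _ IH]; intros Hu.
destruct (classic (exists s, is_step s /\ step_src s = u)) as [(s & Hs & <-)|Hn].
- pose proof (cell2_step Hs) as Cs.
  destruct (IH (step_tgt s) (R_step Hs)) as (v & p & Hv & Hp & Huniq).
  { apply (cell2_tgt HP Cs). }
  exists v, (Comp1 (step_tm s) p); split; [auto|split; [constructor; auto|]].
  intros w q Hw Hq; remember (step_src s) as u eqn:Eu.
  destruct Hq as [u Hu'|s' w q Hs' Hq].
  { destruct (proj2 Hw s Hs); auto. }
  destruct (@local_joined s s') as (x & c & d & Hc & Pc & Hd & Pd & Ecd).
  { repeat split; auto; try apply Hs; apply Hs'. }
  pose proof (cell2_step Hs') as Cs'.
  destruct (positive_path HP E Hc Pc) as (c' & Hc' & Ec).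
  destruct (positive_path HP E Hd Pd) as (d' & Hd' & Ed).
  (* The path from the target of [s] to [x] may be empty, in which case the decrease comes from the
     step [s] itself. *)
  assert (Rx : R x (step_src s)).
  { destruct (path_decreasing Hc') as [<-|]; eauto. }
  (* The meeting point [x] need not be normal. Continuing by [z] turns both closing paths into paths
     to a normal form, to which uniqueness applies. *)
  destruct (IH x) as (y & z & Hy & Hz & _).
  { rewrite Eu; auto. }
  { apply (cell2_tgt HP Hc). }
  destruct (path_comp1 E Hc' Hz) as (k & Hk & Ek).
  destruct (path_comp1 E Hd' Hz) as (l & Hl & El).
  destruct (Huniq y k Hy Hk) as [-> Ekp].
  destruct (IH (step_tgt s')) as (v' & p' & _ & _ & Huniq').
  { auto. } { apply (cell2_tgt HP Cs'). }
  destruct (Huniq' w q Hw Hq) as [-> Eq].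
  destruct (Huniq' v l Hy Hl) as [-> El'].
  split; auto.
  pose proof (path_cell2 Hz) as Cz.
  (* In composition order the chain is [s' q = s' p' = s' l = s' (d z) = s (c z) = s k = s p]; the
     closing square of the branching gives the equality in the middle. *)
  eapply eq2_trans; [eapply eq2_comp1_r; [eauto|exact Eq]|].
  eapply eq2_trans; [eapply eq2_comp1_r; [eauto|apply eq2_sym, El']|].
  eapply eq2_trans; [eapply eq2_comp1_r; [eauto|exact El]|].
  eapply eq2_trans; [eapply eq2_comp1_r; [eauto|eapply eq2_comp1_l; eauto]|].
  eapply eq2_trans; [eapply eq2_assoc1_r; eauto|].
  rewrite <- Eu in Ecd.
  eapply eq2_trans; [eapply eq2_comp1_l; [apply eq2_sym, Ecd|eauto]|].
  eapply eq2_trans; [eapply eq2_assoc1; eauto|].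
  eapply eq2_comp1_r; [eauto|].
  eapply eq2_trans; [|exact Ekp].
  eapply eq2_trans; [|apply eq2_sym, Ek].
  eapply eq2_comp1_l; eauto using eq2_sym.
- assert (Nu : normal u).
  { split; auto; intros s Hs Es; apply Hn; eauto. }
  exists u, (Id2 u); split; [auto|split; [constructor; auto|]].
  intros w q Hw Hq; destruct (path_normal Hq Nu) as [-> ->].
  auto using eq2_refl, cell2_id.
Qed.

Lemma normal_path_unique u v w p q :
  cell1 u -> normal v -> normal w -> path u v p -> path u w q ->
  w = v /\ eq2 E u v q p.
Proof.
intros Hu Hv Hw Hp Hq; destruct (normalize Hu) as (x & r & Hx & Hr & H).
destruct (H v p Hv Hp) as [-> Ep], (H w q Hw Hq) as [-> Eq].
eauto using eq2_trans, eq2_sym.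
Qed.

(** Quantifying over all paths [p] and [q] to normal forms makes the statement symmetric enough for
    inverses, and lets composites insert any path from the intermediate word. *)
Lemma normal_path_absorb u v f : cell2 u v f ->
  forall x y p q, normal x -> normal y -> path u x p -> path v y q ->
  y = x /\ eq2 E u x (Comp1 f q) p.
Proof.
induction 1 as [a|u Hu|u v u' v' f g Hf IHf Hg IHg Es|u v w f g Hf IHf Hg IHg|
  u v f Hf IHf]; intros x y p q Hx Hy Hp Hq.
- assert (path (s1 a) y (Comp1 (step_tm (gen_step a)) q)) as Hq'.
  { rewrite <- step_src_gen; constructor; [apply is_step_gen|].
    rewrite step_tgt_gen; auto. }
  destruct (@normal_path_unique _ x y p _ (proj1 (HP a)) Hx Hy Hp Hq') as [-> K].
  split; auto; eapply eq2_trans; [|exact K].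
  eapply eq2_comp1_l; eauto using eq2_sym, step_tm_gen, path_cell2.
- destruct (@normal_path_unique _ x y p q Hu Hx Hy Hp Hq) as [-> K].
  split; auto; eapply eq2_trans; [apply eq2_idl1|]; eauto using path_cell2.
- destruct (cell2_boundary HP Hf) as (B1 & B2 & B3 & B4).
  destruct (cell2_boundary HP Hg) as (B5 & B6 & B7 & B8).
  destruct (normalize B1) as (n & pn & Hn & Hpn & _).
  destruct (normalize B2) as (m & pm & Hm & Hpm & _).
  destruct (normalize B5) as (n' & pn' & Hn' & Hpn' & _).
  destruct (normalize B6) as (m' & pm' & Hm' & Hpm' & _).
  destruct (IHf n m pn pm) as [-> Ef]; auto.
  destruct (IHg n' m' pn' pm') as [-> Eg]; auto.
  assert (Es' : stop v = start v') by congruence.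
  assert (Hnn : stop n = start n').
  { rewrite <- (cell2_stop HP (path_cell2 Hpn)).
    rewrite <- (cell2_start HP (path_cell2 Hpn')); auto. }
  (* A concatenation of normal forms need not be normal, so a further path [r] leads from it to a
     normal form [z]. *)
  destruct (@normalize (wcat n n')) as (z & r & Hz & Hr & _).
  { apply cell1_wcat; auto; [apply Hn|apply Hn']. }
  (* Normalising both factors and then following [r] is a path to [z]. It is used for the source and
     for the target, and uniqueness compares the results with [p] and [q]. *)
  assert (K : forall u u' p p', path u n p -> path u' n' p' -> stop u = start u' ->
    exists h, path (wcat u u') z h /\
      eq2 E (wcat u u') z h (Comp1 (Comp0 p p') r)).
  { intros a b c d Hc Hd Eab.
    pose proof (path_cell2 Hc) as Cc; pose proof (path_cell2 Hd) as Cd.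
    destruct (path_whisker_r HP E Hc (cell2_src HP Cd) Eab) as (h & Hh & Eh).
    destruct (path_whisker_l HP E Hd (cell2_tgt HP Cc)) as (k & Hk & Ek).
    { rewrite <- (cell2_stop HP Cc); auto. }
    destruct (path_comp1 E Hh Hk) as (h1 & Hh1 & Eh1).
    destruct (path_comp1 E Hh1 Hr) as (h2 & Hh2 & Eh2).
    exists h2; split; auto.
    eapply eq2_trans; [exact Eh2|]; eapply eq2_comp1_l; eauto using path_cell2.
    eapply eq2_trans; [exact Eh1|].
    eapply eq2_trans; [eapply eq2_comp1; eauto|].
    apply eq2_interchange_l; auto. }
  destruct (K _ _ _ _ Hpn Hpn' Es) as (h & Hh & Eh).
  destruct (K _ _ _ _ Hpm Hpm' Es') as (k & Hk & Ek).
  destruct (@normal_path_unique _ x z p h (cell1_wcat B1 B5 Es) Hx Hz Hp Hh)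
    as [-> Ehp].
  destruct (@normal_path_unique _ x y k q (cell1_wcat B2 B6 Es') Hz Hy Hk Hq)
    as [-> Eqk].
  split; auto.
  pose proof (path_cell2 Hr) as Cr.
  pose proof (path_cell2 Hpm) as Cpm; pose proof (path_cell2 Hpm') as Cpm'.
  eapply eq2_trans; [|exact Ehp].
  eapply eq2_trans; [|apply eq2_sym, Eh].
  assert (Cfg : cell2 (wcat u u') (wcat v v') (Comp0 f g)) by auto using cell2_comp0.
  eapply eq2_trans; [eapply eq2_comp1_r; [exact Cfg|eapply eq2_trans; eauto]|].
  eapply eq2_trans; [eapply eq2_assoc1_r; eauto using cell2_comp0|].
  eapply eq2_comp1_l; [|eauto].
  eapply eq2_trans; [apply eq2_sym; eapply eq2_exchange; eauto|].
  apply eq2_comp0; auto.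
- destruct (normalize (cell2_tgt HP Hf)) as (n & r & Hn & Hr & _).
  destruct (IHf x n p r) as [-> Ef]; auto.
  destruct (IHg x y r q) as [-> Eg]; auto.
  split; auto.
  eapply eq2_trans; [eapply eq2_assoc1; eauto using path_cell2|].
  eapply eq2_trans; [eapply eq2_comp1_r; eauto|exact Ef].
- destruct (IHf y x q p) as [-> Ef]; auto.
  split; auto.
  eapply eq2_trans; [eapply eq2_comp1_r; [eauto using cell2|apply eq2_sym, Ef]|].
  eapply eq2_trans; [eapply eq2_assoc1_r; eauto using cell2, path_cell2|].
  eapply eq2_trans; [eapply eq2_comp1_l; [eapply eq2_invl; eauto|]|];
    eauto using path_cell2, eq2_idl1.
Qed.

(** Composing either cell with the same normalising path [q] gives [p], and [q] is invertible, hence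
    cancels. *)
Theorem convergent_coherent u v f g : cell2 u v f -> cell2 u v g -> eq2 E u v f g.
Proof.
intros Hf Hg.
destruct (normalize (cell2_src HP Hf)) as (n & p & Hn & Hp & _).
destruct (normalize (cell2_tgt HP Hf)) as (m & q & Hm & Hq & _).
destruct (normal_path_absorb Hf Hn Hm Hp Hq) as [-> Ef].
destruct (normal_path_absorb Hg Hn Hm Hp Hq) as [_ Eg].
eapply (@eq2_cancel_r P); eauto using eq2_trans, eq2_sym, path_cell2.
Qed.

End Squier.

(** * Homotopical completion *)

Lemma is_step_mono (P : polygraph2) (A B : C2 P -> Prop) s :
  (forall a, A a -> B a) -> is_step A s -> is_step B s.
Proof. unfold is_step; intuition. Qed.

(** Only the membership of the two rules matters: the steps witnessing a Peiffer form apply the same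
    rules, so the negated conditions transfer too. Hence no inclusion between [A] and [B] is
    assumed. *)
Lemma overlap_mono (P : polygraph2) (A B : C2 P -> Prop) s s' :
  B (rule s) -> B (rule s') -> overlap A s s' -> overlap B s s'.
Proof.
intros Hs Hs' ((H1 & H2 & H3) & H4 & H5 & H6); unfold is_step in *.
assert (K : forall f g, A (rule f) -> A (rule g) -> peiffer_form B f g ->
  peiffer_form A f g).
{ intros f g Hf Hg (f1 & g1 & F & G & L & -> & ->); exists f1, g1.
  simpl in Hf, Hg; repeat split; auto; try apply F; apply G. }
repeat split; intuition.
Qed.

(** Minimality transfers for the same reason: an included branching applies the same two rules in
    smaller contexts. *)
Lemma critical_mono (P : polygraph2) (A B : C2 P -> Prop) s s' :
  B (rule s) -> B (rule s') -> A (rule s) -> A (rule s') ->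
  critical A s s' -> critical B s s'.
Proof.
intros Bs Bs' As As' (Ho & Hmin); split; [eapply overlap_mono; eauto|].
intros f g Hfg Hi; apply Hmin; auto; revert Hfg.
destruct Hi as (w & w' & _ & _ & _ & _ & -> & ->); apply overlap_mono; auto.
Qed.

Section Completion.
Variables (Sigma : polygraph2) (lt : word Sigma -> word Sigma -> Prop).
Hypothesis HSigma : is_polygraph2 Sigma.
Hypothesis lt_order : total_termination_order lt.
Variable S : homotopical_completion lt.
Notation X := (completion_polygraph S).

(** Completion adds no 1-cells, so words over [completed2 S] are words over [Sigma], and only the
    adjoined 2-cells occurring in [f] have to be justified. *)
Lemma completed_cell_congr (u v : word Sigma) f :
  cell2 (P := completed2 S) u v f ->
  (forall a, occ2 (P := completed2 S) (inr a) f ->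
    congr (P := Sigma) (new2_src a) (new2_tgt a)) ->
  congr (P := Sigma) u v.
Proof.
induction 1 as [[a|a]|u Hu|u v u' v' f g _ IHf _ IHg E|u v w f g _ IHf _ IHg|
  u v f _ IH]; simpl; intros Ha; eauto using congr.
- apply congr_cat; auto.
- apply (congr_trans (P := Sigma) (v := v)); auto.
Qed.

Lemma completion_peak (c : new3 S) :
  let A := stage_set (h := S) (stage3 c) in
  is_step A (branch_l c) /\ is_step A (branch_r c) /\
  step_src (branch_l c) = step_src (branch_r c).
Proof. apply completion_branch. Qed.

Lemma stage_congr n :
  (forall a : new2 S, stage2 a < n -> congr (P := Sigma) (new2_src a) (new2_tgt a)) ->
  forall s w f, is_step (stage_set (h := S) n) s ->
  free_cell2 (stage_set (h := S) n) (step_tgt s) w f ->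
  congr (P := Sigma) (step_src s) w.
Proof.
intros Hn s w f Hs (Hf & _ & Of).
apply completed_cell_congr with (f := Comp1 (step_tm s) f).
- eapply cell2_comp1; [|exact Hf]; apply cell2_step.
  eapply is_step_mono; [|exact Hs]; intros; exact I.
- simpl; intros a [[[]|[Ea|[]]]|Oa]; apply Hn.
  + pose proof (proj1 Hs) as Hr; rewrite Ea in Hr; exact Hr.
  + exact (Of _ Oa).
Qed.

(** The critical branching that creates [a] and the paths to its two normal forms use cells of
    earlier stages only, so the two normal forms are already congruent through the peak. *)
Lemma new2_congr (a : new2 S) : congr (P := Sigma) (new2_src a) (new2_tgt a).
Proof.
revert a; apply (well_founded_ind (well_founded_ltof _ (stage2 (h := S)))).
intros a IH; unfold ltof in IH.
destruct (completion_new2 a) as (c & Hc & _).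
destruct (completion_peak c) as (Hl & Hr & Es).
destruct (completion_cells c) as (v & w & f & g & Hf & Hg & _ & _ & H).
rewrite Hc in H.
(* The induction hypothesis now covers exactly the adjoined cells available to the branching of
   [c]. *)
rewrite (completion_stage2 Hc) in IH.
assert (congr (P := Sigma) v w).
{ pose proof (stage_congr IH Hl Hf) as Kf; pose proof (stage_congr IH Hr Hg) as Kg.
  rewrite Es in Kf; eapply congr_trans; [apply congr_sym, Kf|exact Kg]. }
destruct H as (_ & [(_ & -> & -> & _)|(_ & -> & -> & _)]); auto using congr_sym.
Qed.

Lemma completed_congr (u v : word Sigma) :
  congr (P := completed2 S) u v <-> congr (P := Sigma) u v.
Proof.
split.
- intros H; destruct (congr_cell2 H) as (f & Hf).
  eapply completed_cell_congr; eauto using new2_congr.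
- induction 1; eauto using congr.
  + apply (congr_gen (P := completed2 S) (inl a)).
  + apply (congr_cat (P := completed2 S)); auto.
Qed.

Lemma completed_polygraph2 : is_polygraph2 (completed2 S).
Proof.
intros [a|a]; [apply HSigma|].
exact (congr_boundary HSigma (new2_congr a)).
Qed.

Lemma three_cell_cell2 c p q : three_cell (h := S) c p q ->
  exists u v, cell2 u v (new3_src c) /\ cell2 u v (new3_tgt c).
Proof.
intros (u & v & H1 & H2); exists u, v.
pose proof completed_polygraph2 as HX.
split; [apply (eq2_cell2 HX H1)|apply (eq2_cell2 HX H2)].
Qed.

Lemma completion_polygraph3 : is_polygraph3 X.
Proof.
split; [exact completed_polygraph2|intros c].
destruct (completion_cells c) as (v & w & f & g & _ & _ & _ & _ & H).
destruct (added2 c); [destruct H as (_ & [(_ & _ & _ & H)|(_ & _ & _ & H)])|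
  destruct H as (_ & _ & H)]; eapply three_cell_cell2; eauto.
Qed.

Lemma new2_decreasing (a : new2 S) : lt (new2_tgt a) (new2_src a).
Proof.
destruct (completion_new2 a) as (c & Hc & _).
destruct (completion_cells c) as (v & w & f & g & Hf & Hg & Nv & Nw & H).
rewrite Hc in H; destruct H as (Hn & [(L & -> & -> & _)|(L & -> & -> & _)]); auto.
(* In the reverse orientation only the failure of [lt w v] is known. Totality leaves equality, which
   would make the branching confluent, or the wanted inequality. *)
destruct (tto_total lt_order (proj1 Nw) (proj1 Nv)) as [?|[<-|?]]; auto.
- contradiction.
- destruct Hn; exists w, f, g; auto.
Qed.

Lemma completed_rule_decreasing (a : C2 (completed2 S)) : lt (t1 a) (s1 a).
Proof.
destruct a as [a|a]; [|apply new2_decreasing].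
pose proof (tto_step lt_order (is_step_gen a)) as H.
rewrite step_src_gen, step_tgt_gen in H; auto.
Qed.

Lemma completed_step_decreasing s : is_step (@all2 (completed2 S)) s ->
  lt (step_tgt s) (step_src s).
Proof.
intros (_ & Hl & Hr & E1 & E2).
destruct (completed_polygraph2 (rule s)) as (H1 & H2 & H3 & H4).
assert (E3 : stop (lctx s) = start (t1 (rule s))) by congruence.
assert (E4 : stop (t1 (rule s)) = start (rctx s)) by congruence.
apply (tto_catl lt_order); auto.
- exact (cell1_wcat H2 Hr E4).
- exact (cell1_wcat H1 Hr E2).
- apply (tto_catr lt_order); auto using completed_rule_decreasing.
Qed.

(** When a 2-cell has been added, it prolongs the closing 2-cell on the side of its source, so its
    target is the meeting point. *)
Lemma completion_joined (c : new3 S) :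
  joined (@rel3 X) (branch_l c) (branch_r c).
Proof.
pose proof completed_polygraph2 as HX.
assert (K : forall p q, three_cell (h := S) c p q ->
  exists u v, eq2 (@rel3 X) u v p q /\ cell2 u v p).
{ intros p q (u & v & H1 & H2); exists u, v.
  destruct (eq2_cell2 HX H1), (eq2_cell2 HX H2); split; auto.
  eapply eq2_trans; [apply eq2_sym, eq2_free, H1|].
  eapply eq2_trans; [|apply eq2_free, H2].
  apply eq2_base; auto; exists c; auto. }
destruct (completion_peak c) as (Hl & Hr & Es).
destruct (completion_cells c) as (v & w & f & g & Hf & Hg & _ & _ & H).
assert (Cl : cell2 (step_src (branch_l c)) (step_tgt (branch_l c))
  (step_tm (branch_l c))).
{ apply cell2_step; eapply is_step_mono; [|exact Hl]; intros; exact I. }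
assert (Cr : cell2 (step_src (branch_l c)) (step_tgt (branch_r c))
  (step_tm (branch_r c))).
{ rewrite Es; apply cell2_step; eapply is_step_mono; [|exact Hr]; intros; exact I. }
destruct Hf as (Cf & Pf & _), Hg as (Cg & Pg & _).
destruct (added2 c) as [a|].
- destruct H as (_ & [(_ & <- & <- & H)|(_ & <- & <- & H)]).
  + pose proof (cell2_gen (P := completed2 S) (inr a)) as Ca; simpl in Ca.
    destruct (K _ _ H) as (x & y & H' & Hx).
    destruct (cell2_unique Hx (cell2_comp1 (cell2_comp1 Cl Cf) Ca)) as [-> ->].
    exists (new2_tgt a), (Comp1 f (Gen2 (P := completed2 S) (inr a))), g.
    repeat split; auto; [eapply cell2_comp1; eauto|].
    eapply eq2_trans; [|exact H']; eapply eq2_assoc1_r; eauto.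
  + pose proof (cell2_gen (P := completed2 S) (inr a)) as Ca; simpl in Ca.
    destruct (K _ _ H) as (x & y & H' & Hx).
    destruct (cell2_unique Hx (cell2_comp1 Cl Cf)) as [-> ->].
    exists (new2_tgt a), f, (Comp1 g (Gen2 (P := completed2 S) (inr a))).
    repeat split; auto; [eapply cell2_comp1; eauto|].
    eapply eq2_trans; [exact H'|]; eapply eq2_assoc1; eauto.
- destruct H as (_ & <- & H).
  destruct (K _ _ H) as (x & y & H' & Hx).
  destruct (cell2_unique Hx (cell2_comp1 Cl Cf)) as [-> ->].
  exists v, f, g; repeat split; auto.
Qed.

Lemma completed_critical_joined s s' :
  critical (@all2 (completed2 S)) s s' -> joined (@rel3 X) s s'.
Proof.
intros Hc.
(* The rank is the least [n] with the rule in [stage_set n]. An adjoined cell needs a successor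
   because membership asks for a stage strictly below [n]. *)
pose (rank := fun a : C2 (completed2 S) =>
  match a with inl _ => 0 | inr b => Datatypes.S (stage2 b) end).
assert (K : forall n a, rank a <= n -> stage_set (h := S) n a).
{ intros n [a|a]; unfold rank; simpl; auto. }
(* Any common upper bound of the two ranks gives a stage containing both rules; the sum is one. *)
assert (Hc' : critical (stage_set (h := S) (rank (rule s) + rank (rule s'))) s s').
{ apply (critical_mono (A := @all2 (completed2 S)));
    [apply K; lia|apply K; lia|exact I|exact I|exact Hc]. }
destruct (completion_all Hc') as (c & _ & [[<- <-]|[<- <-]]).
- apply completion_joined.
- apply joined_sym; [|apply completion_joined].
  apply (completion_peak c).
Qed.

Lemma completion_coherent u v (f g : tm2 X) :
  cell2 u v f -> cell2 u v g -> eq2 (@rel3 X) u v f g.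
Proof.
apply (@convergent_coherent (completed2 S) completed_polygraph2 (@rel3 X)
  completed_critical_joined (fun u v : word Sigma => cell1 u /\ cell1 v /\ lt u v)).
- exact (tto_wf lt_order).
- intros x y z (? & ? & ?) (? & ? & ?); repeat split; auto.
  eapply (tto_trans lt_order (v := y)); auto.
- intros s Hs; pose proof (cell2_step Hs) as Cs.
  pose proof completed_polygraph2 as HX.
  exact (conj (cell2_tgt HX Cs) (conj (cell2_src HX Cs) (completed_step_decreasing Hs))).
Qed.

End Completion.

(** * 3-cells and Nielsen transformations *)

Lemma cell3_cell2 (X : polygraph3) u v f g (F : tm3 X) : is_polygraph2 X ->
  cell3 u v f g F -> cell2 u v f /\ cell2 u v g.
Proof.
intros HX; induction 1;
  repeat match goal with H : _ /\ _ |- _ => destruct H end;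
  eauto using cell2.
match goal with H : eq2 _ _ _ f _ |- _ => destruct (eq2_cell2 HX H) end.
match goal with H : eq2 _ _ _ g _ |- _ => destruct (eq2_cell2 HX H) end.
auto.
Qed.

(** Because of [cell3_conv], the boundary of a generator is fixed only up to equality in the free
    (2,1)-category. *)
Lemma cell3_gen_inv (X : polygraph3) u v f g (c : C3 X) :
  cell3 u v f g (Gen3 c) ->
  eq2 (@free2 X) u v (s2 c) f /\ eq2 (@free2 X) u v (t2 c) g.
Proof.
intros H; remember (Gen3 c) as F eqn:EF; revert EF.
induction H; intros EF; try discriminate EF.
- injection EF as <-; auto using eq2_refl.
- destruct (IHcell3 EF); split; eapply eq2_trans; eauto.
Qed.

Section ThreeCells.
Variable X : polygraph3.
Hypothesis HX : is_polygraph2 X.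

(** Only the generators that occur in [F] have to lie in [E]. This is what permits induction along
    the order on 3-cells. *)
Lemma cell3_eq2 (E : tm2 X -> tm2 X -> Prop) u v f g (F : tm3 X) :
  cell3 u v f g F -> (forall c, occ3 c F -> E (s2 c) (t2 c)) ->
  eq2 E u v f g.
Proof.
induction 1; simpl; intros HE.
- apply eq2_base; auto.
- auto using eq2_refl.
- apply eq2_comp0; auto.
- eapply eq2_comp1; eauto.
- eapply eq2_trans; eauto.
- apply eq2_sym; auto.
- eapply eq2_trans; [apply eq2_sym, eq2_free; eauto|].
  eapply eq2_trans; [eauto|apply eq2_free; auto].
Qed.

Lemma nielsen3_parallel (f g f' g' : tm2 X) :
  nielsen3 f g f' g' -> (exists u v, cell2 u v f /\ cell2 u v g) ->
  exists u v, cell2 u v f' /\ cell2 u v g'.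
Proof.
induction 1 as [u v f g f' g' Ef Eg|f g|u u' v v' f g h k Hf Hg Hh Hk|]; auto.
- intros _; exists u, v; split; [apply (eq2_cell2 HX Ef)|apply (eq2_cell2 HX Eg)].
- intros (u & v & ? & ?); eauto.
- intros _; exists u', v'; split; repeat eapply cell2_comp1; eauto.
Qed.

(** Nielsen transformations can be undone modulo [E]: inversion is symmetry, and the 2-cells
    composed on both sides cancel. *)
Lemma nielsen3_eq2 (E : tm2 X -> tm2 X -> Prop) (f g f' g' : tm2 X) :
  nielsen3 f g f' g' -> (exists u v, eq2 E u v f' g') -> exists u v, eq2 E u v f g.
Proof.
induction 1 as [u v f g f' g' Ef Eg|f g|u u' v v' f g h k Hf Hg Hh Hk|]; auto.
- intros (x & y & H); exists u, v.
  destruct (cell2_unique (proj1 (eq2_cell2 HX H)) (proj2 (eq2_cell2 HX Ef)))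
    as [-> ->].
  eapply eq2_trans; [apply eq2_free, Ef|].
  eapply eq2_trans; [exact H|apply eq2_sym, eq2_free, Eg].
- intros (x & y & H); eauto using eq2_sym.
- intros (x & y & H); exists u, v.
  destruct (cell2_unique (proj1 (eq2_cell2 HX H))
    (cell2_comp1 (cell2_comp1 Hh Hf) Hk)) as [-> ->].
  eapply eq2_cancel_l; eauto; eapply eq2_cancel_r; eauto using cell2.
Qed.

(** For laws whose two sides have boundaries equal only by a law of 2-cells, one side is retyped
    with [cell3_conv]. *)
Lemma eq3_cell3 u v f g (F G : tm3 X) :
  eq3 u v f g F G -> cell3 u v f g F /\ cell3 u v f g G.
Proof.
induction 1;
  repeat match goal with
  | H : _ /\ _ |- _ => destruct H
  | H : cell3 _ _ _ _ _ |- _ =>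
      let A := fresh in pose proof (cell3_cell2 HX H) as A; destruct A;
      revert H
  end; intros; try (split; solve [eauto using cell3, cell3_cell2]).
- destruct (eq2_cell2 HX H) as [Hf Hg]; split.
  + eapply cell3_conv; [apply cell3_id, Hf|apply eq2_refl; auto|auto].
  + eapply cell3_conv; [apply cell3_id, Hg|apply eq2_sym; auto|apply eq2_refl; auto].
- split; [|eauto using cell3].
  eapply cell3_conv; [eauto using cell3|eapply eq2_assoc1; eauto..].
- split; auto.
  eapply cell3_conv; [|eapply eq2_idl1; eauto..].
  eapply cell3_star1; eauto using cell3_id, cell2_id, cell2_src.
- split; auto.
  eapply cell3_conv; [|eapply eq2_idr1; eauto..].
  eapply cell3_star1; eauto using cell3_id, cell2_id, cell2_tgt.
- split; [|repeat apply cell3_star0; auto].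
  eapply cell3_conv; [|apply eq2_assoc0; auto..].
  rewrite <- !wcat_assoc; repeat apply cell3_star0; auto.
  rewrite stop_wcat; auto.
- split; auto.
  eapply cell3_conv; [|apply eq2_idl0; auto..].
  rewrite <- (id1_wcat u), <- (@id1_wcat_start _ (start u) v) at 1
    by eauto using cell2_start.
  apply cell3_star0; auto; apply cell3_id, cell2_id; exact I.
- split; auto.
  eapply cell3_conv; [|apply eq2_idr0; auto..].
  rewrite <- (wcat_id1 u (stop u)), <- (wcat_id1 v (stop u)) at 1.
  apply cell3_star0; auto; apply cell3_id, cell2_id; exact I.
- split; [|eauto using cell3, cell2].
  eapply cell3_star1; apply cell3_id; eauto.
- split; [|apply cell3_id, cell2_comp0; auto].
  eapply cell3_star0; auto; apply cell3_id; eauto.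
- split.
  + eapply cell3_conv; [|eapply eq2_exchange; eauto..].
    apply cell3_star0; eauto using cell3.
  + eapply cell3_star1; eapply cell3_star0; eauto using cell2_composable.
Qed.

Lemma nielsen4_sphere (F G F' G' : tm3 X) :
  nielsen4 F G F' G' -> sphere3 F G -> sphere3 F' G'.
Proof.
induction 1 as [u v f g F G F' G' EF EG| | |]; auto; intros _.
exists u, v, f, g; split; [apply (eq3_cell3 EF)|apply (eq3_cell3 EG)].
Qed.

End ThreeCells.

(** * Homotopical reduction *)

Section Reduction.
Variables (X : polygraph3) (K : collapsible_part X).
Hypothesis HX : is_polygraph3 X.
Notation Y := (reduction K).
Notation pi_word := (@Defs.pi_word X K).
Notation pi1 := (@Defs.pi1 X K).
Notation pi2 := (@Defs.pi2 X K).
Notation pi_tm2 := (@Defs.pi_tm2 X K).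
Implicit Types (u v : word X) (f g : tm2 X).

Let HX2 : is_polygraph2 X := proj1 HX.

Lemma pi_word_wcat u v : pi_word (wcat u v) = wcat (pi_word u) (pi_word v).
Proof. unfold Defs.pi_word, wcat; simpl; rewrite flat_map_app; reflexivity. Qed.

(** The hypothesis concerns only the letters of [l], so that the lemma applies inside the
    well-founded induction establishing it for every letter. *)
Lemma pi_letters_path (x : C0 X) (l : list (C1 X)) :
  (forall y, In y l -> path_from (G := Y) (s0 y) (pi1 y) /\
    end_from (G := Y) (s0 y) (pi1 y) = t0 y) ->
  path_from (G := X) x l -> path_from (G := Y) x (flat_map pi1 l) /\
  end_from (G := Y) x (flat_map pi1 l) = end_from (G := X) x l.
Proof.
revert x; induction l as [|y l IH]; simpl; intros x H Hl; auto.
destruct Hl as [<- Hl]; destruct (H y (or_introl eq_refl)) as [H1 H2].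
destruct (IH (t0 y)) as [H3 H4]; auto.
rewrite path_from_app, end_from_app, H2; auto.
Qed.

Lemma collapse2_boundary c u x : collapse2 K c = Some (u, x) ->
  cell1 u /\ start u = s0 x /\ stop u = t0 x.
Proof.
intros H; destruct (HX2 c) as (H1 & H2 & H3 & H4).
destruct (collapsible2 H) as [[[E1 E2]|[E1 E2]] _]; rewrite E1, E2 in *;
  unfold stop in *; simpl in *; auto.
Qed.

Lemma pi1_path (x : C1 X) : path_from (G := Y) (s0 x) (pi1 x) /\
  end_from (G := Y) (s0 x) (pi1 x) = t0 x.
Proof.
induction x as [x IH] using (well_founded_induction (lt1_wf K)).
destruct (classic (redundant1 K x)) as [(u & c & H)|H].
- rewrite (pi1_redundant H).
  destruct (collapse2_boundary H) as (H1 & H2 & H3).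
  rewrite <- H2, <- H3; apply pi_letters_path; auto.
  intros y Hy; apply IH; eapply collapse2_lt; eauto.
- rewrite (pi1_kept H); simpl; auto.
Qed.

Lemma pi_word_boundary u : cell1 u -> cell1 (pi_word u) /\ stop (pi_word u) = stop u.
Proof. apply pi_letters_path; intros y _; apply pi1_path. Qed.

Lemma pi_word_cell1 u : cell1 u -> cell1 (pi_word u).
Proof. apply pi_word_boundary. Qed.

Lemma pi_word_stop u : cell1 u -> stop (pi_word u) = stop u.
Proof. apply pi_word_boundary. Qed.

Lemma pi_word_composable u v u' v' f g :
  cell2 u v f -> cell2 u' v' g -> stop u = start u' ->
  stop (pi_word u) = start (pi_word u').
Proof. intros Hf _ E; rewrite pi_word_stop; eauto using cell2_src. Qed.

Lemma map2_cell2 (h : C2 X -> tm2 (reduced2 K)) u v f :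
  cell2 u v f ->
  (forall a, occ2 a f ->
    cell2 (P := reduced2 K) (pi_word (s1 a)) (pi_word (t1 a)) (h a)) ->
  cell2 (P := reduced2 K) (pi_word u) (pi_word v) (map2 h f).
Proof.
induction 1; simpl; intros Hh.
- apply Hh; auto.
- apply cell2_id, pi_word_cell1; auto.
- rewrite !pi_word_wcat; apply cell2_comp0; eauto using pi_word_composable.
- eapply cell2_comp1; eauto.
- apply cell2_inv; auto.
Qed.

(** Nielsen transformations preserve parallelism, and the target [Gen2 x] fixes the common
    boundary. *)
Lemma collapse3_cell2 c f x : collapse3 K c = Some (f, x) -> cell2 (s1 x) (t1 x) f.
Proof.
intros H; destruct (collapsible3 H) as [Hn _].
destruct (nielsen3_parallel HX2 Hn (proj2 HX c)) as (u & v & Hf & Hx).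
destruct (cell2_unique Hx (cell2_gen x)) as [-> ->]; auto.
Qed.

Lemma pi2_cell2 (x : C2 X) :
  cell2 (P := reduced2 K) (pi_word (s1 x)) (pi_word (t1 x)) (pi2 x).
Proof.
induction x as [x IH] using (well_founded_induction (lt2_wf K)).
destruct (classic (redundant2 K x)) as [(f & c & H)|H].
- rewrite (pi2_redundant H); apply map2_cell2.
  + apply (collapse3_cell2 H).
  + intros y Hy; apply IH; eapply collapse3_lt; eauto.
- destruct (collapse2 K x) as [[u y]|] eqn:Ex.
  + rewrite (pi2_collapsed Ex).
    destruct (collapse2_boundary Ex) as (Hu & E1 & E2).
    (* The redundant letter and the source of its collapsed 2-cell have the same image, so an
       identity has the right boundary for either orientation. *)
    assert (E : pi_word (letter y) = pi_word u).
    { unfold Defs.pi_word; simpl.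
      rewrite (pi1_redundant Ex), app_nil_r, E1; reflexivity. }
    destruct (collapsible2 Ex) as [[[-> ->]|[-> ->]] _]; rewrite E;
      apply cell2_id, pi_word_cell1; auto.
  + rewrite (pi2_kept (conj Ex H)).
    exact (cell2_gen (P := reduced2 K) (exist _ x (conj Ex H))).
Qed.

Lemma pi_cell2 u v f :
  cell2 u v f -> cell2 (P := reduced2 K) (pi_word u) (pi_word v) (pi_tm2 f).
Proof. intros Hf; apply map2_cell2; auto using pi2_cell2. Qed.

Lemma reduced_polygraph2 : is_polygraph2 (reduced2 K).
Proof.
intros [x Hx]; destruct (HX2 x) as (H1 & H2 & H3 & H4); simpl.
unfold parallel1; simpl; rewrite !pi_word_stop; auto using pi_word_cell1.
Qed.

Lemma reduction_polygraph3 : is_polygraph3 Y.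
Proof.
split; [exact reduced_polygraph2|intros [c Hc]].
destruct (proj2 HX c) as (u & v & H1 & H2).
exists (pi_word u), (pi_word v); simpl; auto using pi_cell2.
Qed.

(** * 2-cells identified by the projection *)

Lemma pi_eq2 (E : tm2 X -> tm2 X -> Prop) (E' : tm2 Y -> tm2 Y -> Prop) u v f g :
  (forall u v f g, E f g -> cell2 u v f -> cell2 u v g ->
    eq2 (P := reduced2 K) E' (pi_word u) (pi_word v) (pi_tm2 f) (pi_tm2 g)) ->
  eq2 E u v f g ->
  eq2 (P := reduced2 K) E' (pi_word u) (pi_word v) (pi_tm2 f) (pi_tm2 g).
Proof.
intros HE H; pose proof HX2; induction H;
  rewrite ?pi_word_wcat; eauto.
- apply eq2_refl, pi_cell2; auto.
- apply eq2_sym; auto.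
- eapply eq2_trans; eauto.
- apply eq2_comp0; auto.
  rewrite pi_word_stop; auto; eapply cell2_src; auto; eapply eq2_cell2; eauto.
- eapply eq2_comp1; eauto.
- apply eq2_inv; auto.
- eapply eq2_assoc1; eauto using pi_cell2.
- apply eq2_idl1, pi_cell2; auto.
- apply eq2_idr1, pi_cell2; auto.
- eapply eq2_invr; eauto using pi_cell2.
- eapply eq2_invl; eauto using pi_cell2.
- apply eq2_assoc0; eauto using pi_cell2, pi_word_composable.
- apply (eq2_idl0 (P := reduced2 K) E' (pi_cell2 H)).
- rewrite <- (pi_word_stop (cell2_src HX2 H)).
  apply (eq2_idr0 (P := reduced2 K) E' (pi_cell2 H)).
- unfold Defs.pi_tm2; simpl; rewrite pi_word_wcat.
  apply eq2_id0; auto using pi_word_cell1; rewrite pi_word_stop; auto.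
- eapply eq2_exchange; eauto using pi_cell2, pi_word_composable.
Qed.

(* This congruence contains the boundaries of all the 3-cells of [X], including
   those removed by the reduction. *)
Definition pi_related f g : Prop :=
  exists u v, cell2 u v f /\ cell2 u v g /\
    eq2 (P := reduced2 K) (@rel3 Y) (pi_word u) (pi_word v) (pi_tm2 f) (pi_tm2 g).

Lemma pi_related_eq2 u v f g : eq2 pi_related u v f g ->
  eq2 (P := reduced2 K) (@rel3 Y) (pi_word u) (pi_word v) (pi_tm2 f) (pi_tm2 g).
Proof.
apply pi_eq2; clear; intros u v f g (x & y & Hf & Hg & H) Hf' _.
destruct (cell2_unique Hf Hf') as [-> ->]; auto.
Qed.

Lemma eq2_pi_related u v f g : eq2 pi_related u v f g -> pi_related f g.
Proof.
intros H; exists u, v; destruct (eq2_cell2 HX2 H).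
auto using pi_related_eq2.
Qed.

(** Induction along the order on 3-cells, needed for the redundant ones; collapsed cells are settled
    by the recursive definition of [pi2], and kept cells generate the reduction. *)
Lemma pi_rel3 c : pi_related (s2 c) (t2 c).
Proof.
induction c as [c IH] using (well_founded_induction (lt3_wf K)).
destruct (proj2 HX c) as (u & v & Hs & Ht).
destruct (collapse3 K c) as [[f x]|] eqn:Ec;
  [|destruct (classic (redundant3 K c)) as [(H & [F G] & Hr)|Hr]].
(* Since [pi2 x] is the image of [f], the modified boundary has two equal images; undoing the
   Nielsen transformation relates the original one. *)
- destruct (collapsible3 Ec) as [Hn _].
  destruct (@nielsen3_eq2 _ HX2 pi_related _ _ _ _ Hn) as (x1 & y1 & H);
    [|eauto using eq2_pi_related].
  pose proof (collapse3_cell2 Ec) as Hf.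
  exists (s1 x), (t1 x); apply eq2_base; auto using cell2_gen.
  exists (s1 x), (t1 x); repeat split; auto using cell2_gen.
  unfold Defs.pi_tm2; simpl; rewrite (pi2_redundant Ec); apply eq2_refl, pi_cell2; auto.
(* The sphere supplies another 3-cell [H] parallel to [Gen3 c], built from smaller generators
   only. *)
- destruct (collapsible4 Hr) as (Hs3 & Hn & _).
  destruct (nielsen4_sphere HX2 Hn Hs3) as (x & y & f & g & HF & Hc).
  destruct (cell3_gen_inv Hc) as [Ef Eg].
  apply (@eq2_pi_related x y).
  eapply eq2_trans; [apply eq2_free, Ef|].
  eapply eq2_trans; [|apply eq2_sym, eq2_free, Eg].
  eapply cell3_eq2; [exact HF|].
  intros d Hd; apply IH; eapply collapse4_lt; eauto.
- exists u, v; repeat split; auto.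
  apply eq2_base; auto using pi_cell2.
  exists (exist _ c (conj Ec Hr)); auto.
Qed.

(** * Lifting along the inclusion of the kept generators *)

Implicit Types w : word (reduced2 K).

Definition incl_word w : word X :=
  Word (G := X) (start w) (map (@proj1_sig _ _) (letters w)).

Lemma incl_word_wcat w w' :
  incl_word (wcat w w') = wcat (incl_word w) (incl_word w').
Proof. unfold incl_word, wcat; simpl; rewrite map_app; reflexivity. Qed.

Lemma incl_word_boundary w :
  (cell1 (incl_word w) <-> cell1 w) /\ stop (incl_word w) = stop w.
Proof.
destruct w as [x l]; unfold cell1, stop; simpl.
revert x; induction l as [|y l IH]; simpl; intros x; [tauto|].
destruct (IH (t0 (proj1_sig y))); intuition.
Qed.

Lemma incl_word_cell1 w : cell1 w -> cell1 (incl_word w).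
Proof. apply incl_word_boundary. Qed.

Lemma pi_incl_word w : pi_word (incl_word w) = w.
Proof.
destruct w as [x l]; unfold Defs.pi_word, incl_word; simpl; f_equal.
induction l as [|[y Hy] l IH]; simpl; auto.
rewrite (pi1_kept Hy), IH; reflexivity.
Qed.

(** The image is an identity already in the free (2,1)-category, so conjugation by such cells is
    invisible to [pi] before any 3-cell is used. *)
Definition contractible u : Prop :=
  exists f, cell2 u (incl_word (pi_word u)) f /\
    eq2 (P := reduced2 K) (@free2 Y) (pi_word u) (pi_word u) (pi_tm2 f)
      (Id2 (P := reduced2 K) (pi_word u)).

Lemma contractible_letters u :
  cell1 u -> (forall y, In y (letters u) -> contractible (letter y)) ->
  contractible u.
Proof.
destruct u as [x l]; revert x; induction l as [|y l IH]; intros x Hu Hl.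
- exists (Id2 (P := X) (Word (G := X) x [])); split; [apply cell2_id; exact I|].
  apply eq2_refl, cell2_id; exact I.
- change (s0 y = x /\ cell1 (Word (G := X) (t0 y) l)) in Hu.
  destruct Hu as [<- Hu].
  destruct (Hl y (or_introl eq_refl)) as (f & Hf & Ef).
  destruct (IH (t0 y) Hu) as (g & Hg & Eg); [intros; apply Hl; right; auto|].
  change (Word (G := X) (s0 y) (y :: l)) with
    (wcat (letter y) (Word (G := X) (t0 y) l)).
  exists (Comp0 f g); rewrite pi_word_wcat, incl_word_wcat; split.
  + apply cell2_comp0; auto.
  + assert (Es : stop (pi_word (letter y)) = t0 y).
    { rewrite pi_word_stop; [reflexivity|split; auto; exact I]. }
    eapply eq2_trans; [apply eq2_comp0; eauto|].
    apply eq2_id0; auto; apply pi_word_cell1; auto; split; auto; exact I.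
Qed.

Lemma contractible_letter (x : C1 X) : contractible (letter x).
Proof.
induction x as [x IH] using (well_founded_induction (lt1_wf K)).
destruct (classic (redundant1 K x)) as [(u & c & H)|H].
- destruct (collapse2_boundary H) as (Hu & E1 & E2).
  destruct (contractible_letters Hu) as (f & Hf & Ef).
  { intros y Hy; apply IH; eapply collapse2_lt; eauto. }
  assert (E : pi_word (letter x) = pi_word u).
  { unfold Defs.pi_word; simpl.
    rewrite (pi1_redundant H), app_nil_r, E1; reflexivity. }
  assert (Cu : cell2 (P := reduced2 K) (pi_word u) (pi_word u)
    (Id2 (P := reduced2 K) (pi_word u))).
  { apply cell2_id, pi_word_cell1; auto. }
  (* The collapsed 2-cell [c] links [x] and [u] in one direction or the other; in either case its
     image is an identity. *)
  assert (exists g, cell2 (letter x) u g /\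
    eq2 (P := reduced2 K) (@free2 Y) (pi_word u) (pi_word u)
    (pi_tm2 g) (Id2 (P := reduced2 K) (pi_word u))) as (g & Hg & Eg).
  { pose proof (cell2_gen c) as Hc.
    destruct (collapsible2 H) as [[[E3 E4]|[E3 E4]] _]; rewrite E3, E4 in Hc.
    - exists (Inv2 (Gen2 c)); split; [apply cell2_inv; auto|].
      unfold Defs.pi_tm2; simpl; rewrite (pi2_collapsed H).
      (* The inverse of an identity is an identity: a unit is inserted in front and cancelled
         against the inverse. *)
      eapply eq2_trans; [apply eq2_sym, eq2_idl1, cell2_inv; auto|].
      eapply eq2_invr; exact Cu.
    - exists (Gen2 c); split; auto; unfold Defs.pi_tm2; simpl; rewrite (pi2_collapsed H).
      apply eq2_refl; auto. }
  exists (Comp1 g f); rewrite E; split; [eapply cell2_comp1; eauto|].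
  eapply eq2_trans; [eapply eq2_comp1; eauto|apply eq2_idl1; auto].
- assert (E : pi_word (letter x) = letter (G := Y) (exist _ x H)).
  { unfold Defs.pi_word; simpl; rewrite (pi1_kept H); reflexivity. }
  exists (Id2 (P := X) (letter x)); split.
  + rewrite E; apply cell2_id; split; auto; exact I.
  + apply eq2_refl, cell2_id, pi_word_cell1; split; auto; exact I.
Qed.

Lemma all_contractible u : cell1 u -> contractible u.
Proof. intros Hu; apply contractible_letters; auto using contractible_letter. Qed.

(** Fullness of [pi] up to free equality. Only a generator is problematic, because its boundary in
    [X] may contain redundant letters. *)
Lemma lift_cell2 (w w' : word (reduced2 K)) (f : tm2 Y) : cell2 w w' f ->
  exists g, cell2 (incl_word w) (incl_word w') g /\
    eq2 (P := reduced2 K) (@free2 Y) w w' (pi_tm2 g) f.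
Proof.
induction 1 as [[a Ha]|w Hw|u v u' v' f g Hf [f' [Cf Ef]] Hg [g' [Cg Eg]] E
  |u v w f g Hf [f' [Cf Ef]] Hg [g' [Cg Eg]]|u v f Hf [f' [Cf Ef]]].
- destruct (all_contractible (proj1 (HX2 a))) as (p & Hp & Ep).
  destruct (all_contractible (proj1 (proj2 (HX2 a)))) as (q & Hq & Eq).
  pose proof (cell2_gen a) as Ca.
  (* The contractions [p] and [q] replace the source and target of [a] by words on kept letters, and
     [pi] erases them. *)
  exists (Comp1 (Inv2 p) (Comp1 (Gen2 a) q)); split.
  + eapply cell2_comp1; [apply cell2_inv, Hp|eapply cell2_comp1; eauto].
  + unfold Defs.pi_tm2; simpl; rewrite (pi2_kept Ha).
    pose proof (cell2_gen (P := reduced2 K) (exist _ a Ha)) as Cy; simpl in Cy.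
    pose proof (cell2_id (P := reduced2 K) (pi_word_cell1 (proj1 (HX2 a)))) as Ci.
    eapply eq2_trans; [eapply eq2_comp1;
      [apply eq2_inv, Ep|eapply eq2_comp1_r; [exact Cy|exact Eq]]|].
    eapply eq2_trans; [eapply eq2_comp1;
      [|apply eq2_idr1; exact Cy]|apply eq2_idl1; exact Cy].
    eapply eq2_trans; [apply eq2_sym, eq2_idl1, cell2_inv; auto|].
    eapply eq2_invr; exact Ci.
- exists (Id2 (P := X) (incl_word w)); split; [apply cell2_id, incl_word_cell1; auto|].
  unfold Defs.pi_tm2; simpl; rewrite pi_incl_word; apply eq2_refl, cell2_id; auto.
- exists (Comp0 f' g'); rewrite !incl_word_wcat; split.
  + apply cell2_comp0; auto; rewrite (proj2 (incl_word_boundary u)); auto.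
  + apply eq2_comp0; auto.
- exists (Comp1 f' g'); split; [eapply cell2_comp1|eapply eq2_comp1]; eauto.
- exists (Inv2 f'); split; [apply cell2_inv|apply eq2_inv]; auto.
Qed.

Lemma reduction_coherent :
  (forall u v f g, cell2 u v f -> cell2 u v g -> eq2 (@rel3 X) u v f g) ->
  forall w w' (f g : tm2 Y), cell2 w w' f -> cell2 w w' g ->
    eq2 (P := reduced2 K) (@rel3 Y) w w' f g.
Proof.
intros H w w' f g Hf Hg.
destruct (lift_cell2 Hf) as (f' & Cf & Ef), (lift_cell2 Hg) as (g' & Cg & Eg).
eapply eq2_trans; [apply eq2_sym, eq2_free, Ef|].
eapply eq2_trans; [|apply eq2_free, Eg].
rewrite <- (pi_incl_word w), <- (pi_incl_word w').
apply pi_related_eq2; eapply eq2_mono; [|apply H; eauto].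
intros ? ? (c & -> & ->); apply pi_rel3.
Qed.

(** Congruent words are those linked by a 2-cell: lifting gives one direction, projection by [pi]
    the other. *)
Lemma incl_congr w w' :
  congr (P := reduced2 K) w w' <-> congr (P := X) (incl_word w) (incl_word w').
Proof.
split; intros H; destruct (congr_cell2 H) as (f & Hf).
- destruct (lift_cell2 Hf) as (g & Hg & _); eapply cell2_congr; eauto.
- rewrite <- (pi_incl_word w), <- (pi_incl_word w').
  eapply cell2_congr, pi_cell2; eauto.
Qed.

End Reduction.

(** * Presented categories *)

Lemma bijective_of_inj_surj (A B : Type) (f : A -> B) :
  (forall x y, f x = f y -> x = y) -> (forall y, exists x, f x = y) ->
  Bijective f.
Proof.
intros Hi Hs.
exists (fun y => proj1_sig (constructive_indefinite_description _ (Hs y))).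
split; intros x; [apply Hi|];
  exact (proj2_sig (constructive_indefinite_description _ (Hs _))).
Qed.

Lemma bijective_comp (A B C : Type) (f : A -> B) (g : B -> C) :
  Bijective f -> Bijective g -> Bijective (fun x => g (f x)).
Proof.
intros (f' & F1 & F2) (g' & G1 & G2); exists (fun z => f' (g' z)).
split; intros; [rewrite G1|rewrite F2]; auto.
Qed.

Lemma isomorphic_trans C D B : isomorphic C D -> isomorphic D B -> isomorphic C B.
Proof.
intros (F & HF & HF') (G & HG & HG').
unshelve eexists.
- refine (@Functor C B (fun x => fobj G (fobj F x))
    (fun x y f => fhom G (fhom F f)) _ _).
  + intros x; rewrite !fhom_id; reflexivity.
  + intros x y z f g; rewrite !fhom_cmp; reflexivity.
- split; [exact (bijective_comp HF HG)|].
  intros x y; exact (bijective_comp (HF' x y) (HG' _ _)).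
Qed.

Section PresentedIso.
Variables (P Q : polygraph2) (o : C0 P -> C0 Q) (h : word P -> word Q).
Hypothesis o_bij : Bijective o.
Hypothesis h_start : forall u, start (h u) = o (start u).
Hypothesis h_stop : forall u, stop (h u) = o (stop u).
Hypothesis h_cell1 : forall u, cell1 u -> cell1 (h u).
Hypothesis h_id1 : forall x, h (id1 x) = id1 (o x).
Hypothesis h_wcat : forall u v, h (wcat u v) = wcat (h u) (h v).
Hypothesis h_congr : forall u v, cell1 u -> cell1 v ->
  congr u v <-> congr (h u) (h v).
Hypothesis h_surj : forall x y w, cell1 w -> start w = o x -> stop w = o y ->
  exists u, cell1 u /\ start u = x /\ stop u = y /\ congr (h u) w.
Hypothesis HP : is_polygraph2 P.

(** The image under [h] is saturated by congruence, since [h] reaches words only up to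
    congruence. *)
Definition image_class (K : word P -> Prop) (w : word Q) : Prop :=
  exists u, K u /\ congr (h u) w.

Lemma image_classE u : cell1 u -> image_class (congr u) = congr (h u).
Proof.
intros Hu; apply functional_extensionality; intros w.
apply propositional_extensionality; split.
- intros (v & Huv & Hw); eapply congr_trans; [|exact Hw].
  apply h_congr; auto; apply (congr_boundary HP Huv).
- intros Hw; exists u; auto using congr_refl.
Qed.

Lemma image_is_class x y K : is_class x y K -> is_class (o x) (o y) (image_class K).
Proof.
intros (u & Hu & <- & <- & ->); exists (h u).
rewrite image_classE; auto.
Qed.

Definition image_hom x y (K : class x y) : class (o x) (o y) :=
  exist _ _ (image_is_class (proj2_sig K)).

(** Reflecting congruence gives faithfulness and [h_surj] gives fullness. It serves both for the
    identity on words and for the inclusion of words on kept letters. *)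
Lemma presented_isomorphic :
  isomorphic (presented_category P) (presented_category Q).
Proof.
unshelve eexists.
- refine (@Functor (presented_category P) (presented_category Q) o image_hom _ _).
  + intros x; apply class_eq; simpl.
    rewrite image_classE, h_id1; [reflexivity|exact I].
  + intros x y z [K (u & Hu & E1 & E2 & ->)] [L (v & Hv & E3 & E4 & ->)].
    apply class_eq; simpl.
    assert (E : stop u = start v) by congruence.
    rewrite class_prodE, !image_classE, class_prodE, h_wcat;
      auto using cell1_wcat; rewrite h_stop, h_start, E; auto.
- split; [exact o_bij|intros x y; apply bijective_of_inj_surj].
  + intros [K (u & Hu & E1 & E2 & ->)] [L (v & Hv & E3 & E4 & ->)] E.
    apply class_eq; simpl; apply (f_equal (@proj1_sig _ _)) in E; simpl in E.
    rewrite !image_classE in E by auto.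
    apply congr_eq, h_congr; auto; rewrite E; apply congr_refl; auto.
  + intros [L (w & Hw & E1 & E2 & ->)].
    destruct (h_surj Hw E1 E2) as (u & Hu & E3 & E4 & H).
    exists (exist _ (congr u) (ex_intro _ u (conj Hu (conj E3 (conj E4 eq_refl))))).
    apply class_eq; simpl; rewrite image_classE by auto; apply congr_eq; auto.
Qed.

End PresentedIso.

(** * Invariance of the presented category, and coherence of the reduction *)

Lemma bijective_id (A : Type) : Bijective (fun x : A => x).
Proof. exists (fun x => x); auto. Qed.

Lemma completed_isomorphic (Sigma : polygraph2)
  (lt : word Sigma -> word Sigma -> Prop) (S : homotopical_completion lt) :
  is_polygraph2 Sigma ->
  isomorphic (presented_category (completed2 S)) (presented_category Sigma).
Proof.
intros H; apply (@presented_isomorphic (completed2 S) Sigma (fun x => x) (fun u => u));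
  auto using bijective_id, completed_polygraph2.
- intros u v _ _; apply completed_congr; auto.
- intros x y w Hw E1 E2; exists w; auto using congr_refl.
Qed.

Lemma reduction_isomorphic (X : polygraph3) (K : collapsible_part X) :
  is_polygraph3 X ->
  isomorphic (presented_category (reduced2 K)) (presented_category X).
Proof.
intros H; apply (@presented_isomorphic (reduced2 K) X (fun x => x) (@incl_word X K));
  auto using bijective_id, reduced_polygraph2, incl_word_cell1, incl_word_wcat.
- intros u; apply incl_word_boundary.
- intros u v _ _; apply incl_congr; auto.
(* The contraction of [w] is a 2-cell from [w] to the inclusion of this preimage, so the two are
   congruent. *)
- intros x y w Hw E1 E2; exists (pi_word K w).
  destruct (pi_word_boundary K H Hw) as [H1 H2].
  repeat split; auto; [simpl in *; congruence|].
  destruct (all_contractible K H Hw) as (f & Hf & _).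
  apply congr_sym; eapply cell2_congr; eauto.
Qed.

Theorem theorem2p3p4 (C : category) (Sigma : polygraph2)
  (lt : word Sigma -> word Sigma -> Prop)
  (Sigma_presents : presents Sigma C)
  (Sigma_terminating : terminating (@all2 Sigma))
  (lt_order : total_termination_order lt)
  (S : homotopical_completion lt)
  (Gamma : collapsible_part (completion_polygraph S)) :
  coherent_presentation (reduction Gamma) C.
Proof.
destruct Sigma_presents as [HS HC].
pose proof (completion_polygraph3 HS S) as HX.
split; [apply reduction_polygraph3; auto|split; [split|]].
- apply reduced_polygraph2; auto.
- eapply isomorphic_trans; [apply (reduction_isomorphic Gamma HX)|].
  eapply isomorphic_trans; [apply (completed_isomorphic S HS)|exact HC].
- apply reduction_coherent; auto.
  intros u v f g; apply completion_coherent; auto.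
Qed.
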